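(* Let $T=T_0+1$. Suppose (autoregressive model with covariates) that for each $i=1,\dots,N$, $$Y^N_{iT}(x)=\sum_{t=1}^{T_0}\langle\beta_t(x,\cdot),Y^N_{it}\rangle_{\mathcal H}+\sum_{\ell=1}^p\eta_\ell(x)Z_{i\ell}+\varepsilon_{iT}(x),\qquad x\in\mathcal X,$$ with $\beta_t\in L^2(\mathcal X\times\mathcal X,\mu\otimes\mu)$, $\eta_\ell\in\mathcal H$, and $\varepsilon_{1T},\dots,\varepsilon_{NT}$ independent mean-zero $\mathcal H$-valued random elements with $\|\varepsilon_{iT}\|_{\mathcal H}\le\sigma$ a.s. The pre-treatment outcomes and covariates are treated as fixed, and $\hat\gamma\in\mathbb R^{N-1}$ with $\sum_{i=2}^N\hat\gamma_i=1$ is a fixed weight vector. Let $\hat\nu^N_{1T}$ be the generic weighting estimator built from $\hat\gamma$. Then for any $\delta>0$, with probability at least $1-2e^{-\delta^2/2}$, $$d(\nu^N_{1T},\hat\nu^N_{1T})\le\sqrt{\sum_{t=1}^{T_0}\|\beta_t\|^2_{\mathcal H\times\mathcal H}}\sqrt{\sum_{t=1}^{T_0}\Big\|Y_{1t}-\sum_{i=2}^N\hat\gamma_iY_{it}\Big\|^2_{\mathcal H}}+\sqrt{\sum_{\ell=1}^p\|\eta_\ell\|^2_{\mathcal H}}\,\Big\|Z_1-\sum_{i=2}^N\hat\gamma_iZ_i\Big\|_2+\delta\sigma(1+\|\hat\gamma\|_2).$$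
   Context: Let $(\mathcal X,\mathcal A,\mu)$ be either a compact interval $\mathcal I\subset\mathbb R$ with Lebesgue measure or the finite set $\{1,\dots,d\}$ with counting measure, and let $\mathcal H=L^2(\mathcal X,\mathcal A,\mu)$ (so $\mathcal H=L^2(\mathcal I)$ or $\mathcal H=\mathbb R^d$), with inner product $\langle f,g\rangle_{\mathcal H}=\int_{\mathcal X}fg\,d\mu$ and norm $\|\cdot\|_{\mathcal H}$. $(\mathcal M,d)$ is a metric space and $\Psi:\mathcal M\to\mathcal H$ is an isometry, $d(a,b)=\|\Psi(a)-\Psi(b)\|_{\mathcal H}$; its image $\mathcal Y=\Psi(\mathcal M)$ is nonempty, closed and convex in $\mathcal H$. Panel setting: units $i=1,\dots,N$, periods $t=1,\dots,T$, $1\le T_0<T$; transformed control potential outcomes $Y^N_{it}\in\mathcal Y$ and observed outcomes $Y_{it}\in\mathcal Y$ with $Y_{it}=Y^N_{it}$ whenever $i\ge2$ or $t\le T_0$; the counterfactual of interest is $\nu^N_{1T}=\Psi^{-1}(Y^N_{1T})$. Each unit has covariates $Z_i=(Z_{i1},\dots,Z_{ip})'\in\mathbb R^p$. Generic weighting estimator: given weights $\hat\gamma\in\mathbb R^{N-1}$ with $\sum_{i=2}^N\hat\gamma_i=1$ not depending on the post-treatment outcomes, set $\hat Y^N_{1T}=\sum_{i=2}^N\hat\gamma_iY_{iT}$, $\tilde Y^N_{1T}=\arg\min_{y\in\mathcal Y}\|y-\hat Y^N_{1T}\|_{\mathcal H}$, and $\hat\nu^N_{1T}=\Psi^{-1}(\tilde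 Y^N_{1T})$. For $\beta\in L^2(\mathcal X\times\mathcal X)$, $\|\beta\|_{\mathcal H\times\mathcal H}=\big(\int\int\beta(x,y)^2\,d\mu(x)d\mu(y)\big)^{1/2}$. *)

(* Defs.v *)
From HB Require Import structures.
From mathcomp Require Import all_boot all_order all_algebra.
From mathcomp Require Import all_classical all_reals all_analysis.
Set Implicit Arguments. Unset Strict Implicit. Unset Printing Implicit Defensive.
Import Order.TTheory GRing.Theory Num.Theory.
Local Open Scope classical_set_scope.
Local Open Scope ring_scope.

(* The underlying measure space (X, A, mu) is encoded as a measure on the real
   line concentrated on X:
   - either mu = Lebesgue measure restricted to the compact interval [a,b];
   - or mu = counting measure restricted to {1,...,d}.
   Then H = L^2(X, mu) = L^2(R, mu). *)
Definition std_space (R : realType)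
  (mu : {measure set (measurableTypeR R) -> \bar R}) : Prop :=
  (exists a b : R, a < b /\
     forall A, measurable A -> mu A = lebesgue_measure (A `&` `[a, b]))
  \/
  (exists d : nat, (0 < d)%N /\
     forall A, measurable A ->
       mu A = counting (A `&` [set (k.+1)%:R | k in [set k : nat | (k < d)%N]])).

Section Hspace.
Variables (R : realType) (mu : {measure set (measurableTypeR R) -> \bar R}).

(* f is (a representative of) an element of H = L^2(mu) *)
Definition memL2 (f : R -> R) : Prop :=
  measurable_fun setT f /\ (\int[mu]_x ((f x) ^+ 2)%:E < +oo)%E.

Definition innerH (f g : R -> R) : R := fine (\int[mu]_x (f x * g x)%:E).

Definition normH (f : R -> R) : R := Num.sqrt (innerH f f).

Definition memL2ker (beta : R * R -> R) : Prop :=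
  measurable_fun setT beta /\
  (\int[mu]_y \int[mu]_x ((beta (x, y)) ^+ 2)%:E < +oo)%E.

Definition normker2 (beta : R * R -> R) : R :=
  fine (\int[mu]_y \int[mu]_x ((beta (x, y)) ^+ 2)%:E).

Definition kerop (beta : R * R -> R) (f : R -> R) : R -> R :=
  fun x => innerH (fun y => beta (x, y)) f.

(* sigma-algebra on H generated by the continuous linear functionals
   f |-> <f, h>_H  (h in H); for the separable Hilbert space H this is the
   Borel sigma-algebra. *)
Definition Hmeasurable : set (set (R -> R)) :=
  smallest (sigma_algebra setT)
    [set A | exists h B, memL2 h /\ measurable (B : set R) /\
             A = [set f | B (innerH f h)]].

End Hspace.

Definition is_metric (M : Type) (R : realType) (d : M -> M -> R) : Prop :=
  (forall a b, 0 <= d a b) /\ (forall a b, d a b = 0 <-> a = b) /\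
  (forall a b, d a b = d b a) /\ (forall a b c, d a c <= d a b + d b c).

Definition euclid_norm (R : realType) (n : nat) (v : 'I_n -> R) : R :=
  Num.sqrt (\sum_(i < n) v i ^+ 2).

Section RandomElements.
Variables (R : realType) (mu : {measure set (measurableTypeR R) -> \bar R}).
Variables (dO : measure_display) (Omega : measurableType dO)
  (P : probability Omega R).

Definition H_random_element (X : Omega -> R -> R) : Prop :=
  (forall w, memL2 mu (X w)) /\
  (forall A, Hmeasurable mu A -> measurable (X @^-1` A)).

Definition H_mean_zero (X : Omega -> R -> R) : Prop :=
  forall h, memL2 mu h -> (\int[P]_w (innerH mu (X w) h)%:E = 0)%E.

Definition H_independent (n : nat) (X : 'I_n -> Omega -> R -> R) : Prop :=
  forall A : 'I_n -> set (R -> R), (forall i, Hmeasurable mu (A i)) ->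
    P [set w | forall i, A i (X i w)] = (\prod_(i < n) P (X i @^-1` A i))%E.

End RandomElements.

(* Main.v *)
Require Import Defs.
From HB Require Import structures.
From mathcomp Require Import all_boot all_order all_algebra.
From mathcomp Require Import all_classical all_reals all_analysis.
From mathcomp Require Import ring lra measurable_realfun.
Import Order.TTheory GRing.Theory Num.Theory numFieldNormedType.Exports.
Local Open Scope classical_set_scope.
Local Open Scope ring_scope.

(** Projecting onto a convex set does not increase the distance to its points, so
    the error is at most the norm of [Y_1T - sum_j gamma_j Y_jT], which the model
    splits into kernel terms, covariate terms and the noise
    [S = eps_1 - sum_j gamma_j eps_j]. The first two are handled by the
    Cauchy-Schwarz inequality.

    For the noise, [cosh (sqrt u)] is convex and increasing in [u >= 0]. Applied to
    [u = |s + x|^2 <= |s|^2 + c^2 + 2 <s, x>] this bounds [cosh |s + x|] by a chord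
    that is affine in [<s, x>], hence [E cosh |s + X| <= cosh |s| cosh c] whenever
    [X] is centred with [|X| <= c]. Iterating over independent summands and using
    [cosh c <= exp (c^2 / 2)], Markov's inequality gives the sub-Gaussian tail with
    its factor 2 (Pinelis).

    The vector [S] is reduced to finitely many real coordinates by orthonormal
    families of normalised indicators: the projections [P_m f] converge to [f]
    almost everywhere by Lebesgue differentiation, and Fatou's lemma then yields
    [|P_m f| -> |f|]. *)

Set Implicit Arguments.
Unset Strict Implicit.
Unset Printing Implicit Defensive.

(** * Hyperbolic cosine *)

Section hyperbolic.
Context {R : realType}.
Implicit Types a b t u v x p : R.

Definition coshR x : R := (expR x + expR (- x)) / 2.
Definition sinhR x : R := (expR x - expR (- x)) / 2.

Lemma coshR_ge0 x : 0 <= coshR x.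
Proof. by rewrite /coshR divr_ge0// addr_ge0// expR_ge0. Qed.

Lemma coshRD a b : coshR (a + b) = coshR a * coshR b + sinhR a * sinhR b.
Proof. by rewrite /coshR /sinhR opprD !expRD; lra. Qed.

Lemma coshRN x : coshR (- x) = coshR x.
Proof. by rewrite /coshR opprK addrC. Qed.

Lemma sinhRN x : sinhR (- x) = - sinhR x.
Proof. by rewrite /sinhR opprK; lra. Qed.

Lemma coshR0 : coshR 0 = 1.
Proof. by rewrite /coshR oppr0 expR0; lra. Qed.

(** Averaging the exponential series at [x] and [- x] cancels the odd terms. Powers of [x ^+ 2] let
    monotonicity, convexity and the Gaussian bound be checked term by term. *)
Lemma cvg_series_coshR x :
  \sum_(k < n) (x ^+ 2) ^+ k / (k.*2)`!%:R @[n --> \oo] --> coshR x.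
Proof.
have e y : series (exp_coeff y) n.*2 @[n --> \oo] --> expR y.
  have h : (fun n : nat => n.*2) @ \oo --> \oo.
    move=> A [N _ NA]; exists N => // n /= Nn; apply: NA => /=.
    by rewrite (leq_trans Nn)// -addnn leq_addr.
  apply: (cvg_comp _ _ h); exact: is_cvg_series_exp_coeff.
rewrite (_ : (fun n : nat => _) = (fun n : nat =>
  (series (exp_coeff x) n.*2 + series (exp_coeff (- x)) n.*2) / 2)); last first.
  apply/funext; elim=> [|n ih].
    by rewrite big_ord0 /series/= !big_geq// addr0 mul0r.
  rewrite big_ord_recr/= ih doubleS /series/= !big_nat_recr//=.
  rewrite /exp_coeff/= !(exprS _ n.*2) -!mul2n !exprM sqrrN.
  set A := \big[_/_]_(_ <= _ < _) _; set B := \big[_/_]_(_ <= _ < _) _.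
  set C := (_ / (2 * n)`!%:R); lra.
by apply: cvgMr_tmp; apply: cvgD; exact: e.
Qed.

Lemma coshR_le u v : 0 <= u -> u <= v -> coshR u <= coshR v.
Proof.
move=> u0 uv; apply: (ler_cvg_to (@cvg_series_coshR u) (@cvg_series_coshR v)).
apply: nearW => n; apply: ler_sum => k _; rewrite ler_wpM2r ?invr_ge0//.
by rewrite -!exprM lerXn2r ?nnegrE// (le_trans u0).
Qed.

(** Termwise comparison of the two series, which comes down to [2 ^ k * k! <= (2 k)!]. *)
Lemma coshR_expR x : coshR x <= expR (x ^+ 2 / 2).
Proof.
apply: (ler_cvg_to (@cvg_series_coshR x) (is_cvg_series_exp_coeff (x ^+ 2 / 2))).
apply: nearW => n; rewrite /series/= big_mkord; apply: ler_sum => k _.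
rewrite /exp_coeff/= expr_div_n -mulrA ler_wpM2l ?(exprn_ge0 _ (sqr_ge0 _))//.
rewrite -invfM lef_pV2 ?posrE ?mulr_gt0 ?exprn_gt0 ?ltr0n ?fact_gt0//.
rewrite -natrX -natrM ler_nat.
elim: (k : nat) => // {k} k ih.
rewrite doubleS !factS expnS mulnACA leq_mul//; first by rewrite mul2n doubleS.
by rewrite (leq_trans ih)// leq_pmull.
Qed.

(** Induction on [k]: the gap left by the induction hypothesis is
    [p (1 - p) (u - v) (u ^+ k - v ^+ k)], whose last two factors have the same sign. *)
Lemma exprn_chord p u v k : 0 <= p <= 1 -> 0 <= u -> 0 <= v ->
  ((1 - p) * u + p * v) ^+ k <= (1 - p) * u ^+ k + p * v ^+ k.
Proof.
move=> /andP[p0 p1] u0 v0; elim: k => [|k ih]; first by rewrite !expr0; lra.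
have q0 : 0 <= 1 - p by rewrite subr_ge0.
rewrite exprS (le_trans (ler_wpM2l _ ih)) ?addr_ge0 ?mulr_ge0//.
rewrite -subr_ge0 !exprS.
rewrite (_ : _ - _ = (p * (1 - p)) * ((u - v) * (u ^+ k - v ^+ k))); last ring.
apply: mulr_ge0; first exact: mulr_ge0.
have [uv|vu] := leP u v.
  by rewrite mulr_le0 ?subr_le0// lerXn2r.
by rewrite mulr_ge0 ?subr_ge0 ?(ltW vu)// lerXn2r// ltW.
Qed.

(* [cosh (sqrt u)] is a power series in [u] with nonnegative coefficients,
   hence convex for [u >= 0]. *)
Lemma coshR_sqrt_chord p a b x : 0 <= p <= 1 ->
  x ^+ 2 = (1 - p) * a ^+ 2 + p * b ^+ 2 ->
  coshR x <= (1 - p) * coshR a + p * coshR b.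
Proof.
move=> p01 xE; apply: (ler_cvg_to (@cvg_series_coshR x)).
  apply: cvgD; apply: cvgMl_tmp; exact: cvg_series_coshR.
apply: nearW => n /=; rewrite !fctE/= !mulr_sumr -big_split/=; apply: ler_sum => k _.
rewrite !mulrA -mulrDl ler_wpM2r ?invr_ge0// xE exprn_chord ?sqr_ge0//.
Qed.

(* The chord of [cosh (sqrt u)] between [(a - b)^2] and [(a + b)^2]; for [a = 0] or
   [b = 0] the convention [0^-1 = 0] is harmless since then [t = 0]. *)
Lemma coshR_step a b t x : 0 <= a -> 0 <= b -> 0 <= x -> `|t| <= a * b ->
  x ^+ 2 <= a ^+ 2 + b ^+ 2 + 2 * t ->
  coshR x <= coshR a * coshR b + t * (sinhR a * a^-1) * (sinhR b * b^-1).
Proof.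
move=> a0 b0 x0 tab xE.
have y0 : 0 <= a ^+ 2 + b ^+ 2 + 2 * t by rewrite (le_trans _ xE)// sqr_ge0.
pose y := Num.sqrt (a ^+ 2 + b ^+ 2 + 2 * t).
have yE : y ^+ 2 = a ^+ 2 + b ^+ 2 + 2 * t by rewrite sqr_sqrtr.
have xy : x <= y by rewrite -(@ler_pXn2r _ 2) ?nnegrE ?sqrtr_ge0// yE.
apply: (le_trans (coshR_le x0 xy)).
have [a00|a00] := eqVneq a 0.
  move: tab yE; rewrite a00 mul0r normr_le0 => /eqP ->.
  rewrite expr0n/= mulr0 add0r addr0 => /eqP; rewrite eqf_sqr => /orP[]/eqP ->;
  by rewrite ?coshRN coshR0 !mul0r mul1r addr0.
have [b00|b00] := eqVneq b 0.
  move: tab yE; rewrite b00 mulr0 normr_le0 => /eqP ->.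
  rewrite expr0n/= mulr0 !addr0 => /eqP; rewrite eqf_sqr => /orP[]/eqP ->;
  by rewrite ?coshRN coshR0 !mul0r mulr1 addr0.
have ab0 : 0 < a * b by rewrite lt0r mulf_neq0//= mulr_ge0.
(* The weight that writes [a ^+ 2 + b ^+ 2 + 2 * t] as a mixture of [(a - b) ^+ 2] and
   [(a + b) ^+ 2]; the bound on [t] puts it in [[0, 1]]. *)
pose p := (1 + t / (a * b)) / 2.
have tE : t = (2 * p - 1) * (a * b) by rewrite /p; field; apply/andP.
have p01 : 0 <= p <= 1.
  move: tab; rewrite ler_norml => /andP[t1 t2].
  have : -1 <= t / (a * b) <= 1.
    by rewrite ler_pdivlMr// ler_pdivrMr// mulN1r mul1r t1 t2.
  by move=> /andP[? ?]; apply/andP; rewrite /p; split; lra.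
apply: (le_trans (@coshR_sqrt_chord p (a - b) (a + b) y p01 _)).
  by rewrite yE tE; ring.
rewrite !coshRD coshRN sinhRN le_eqVlt; apply/orP; left; apply/eqP.
by rewrite tE; field; apply/andP.
Qed.

End hyperbolic.

(** * Independence *)

Lemma Rintegral_sum {d} {T : measurableType d} {R : realType}
    (mu : {measure set T -> \bar R}) (I : Type) (s : seq I) (f : I -> T -> R) :
  (forall i, mu.-integrable setT (EFin \o f i)) ->
  \int[mu]_x (\sum_(i <- s) f i x) = \sum_(i <- s) \int[mu]_x f i x.
Proof.
move=> fi; rewrite /Rintegral.
under eq_integral do rewrite -sumEFin.
rewrite integral_sum// sum_fine// => i _; apply: integrable_fin_num => //; exact: fi.
Qed.

Section independence.
Context {d : measure_display} {Omega : measurableType d} {R : realType}.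
Variable P : probability Omega R.

Lemma bounded_integrable (f : Omega -> R) (M : R) :
  measurable_fun setT f -> (forall w, `|f w| <= M) ->
  P.-integrable setT (EFin \o f).
Proof.
move=> mf fM; apply: measurable_bounded_integrable => //.
  by rewrite (le_lt_trans (probability_le1 _ _))// ltry.
by exists M; split; rewrite ?num_real// => x Mx w _ /=; rewrite (le_trans (fM w))// ltW.
Qed.

(** Independence makes the joint law of [(U, V)] a product measure. By Fubini the integral over [U]
    can be taken first, and it vanishes for each fixed value of [V]. *)
Lemma integralM_indep (U V : {RV P >-> R}) :
  (forall A B : set R, measurable A -> measurable B ->
    P (U @^-1` A `&` V @^-1` B) = (P (U @^-1` A) * P (V @^-1` B))%E) ->
  P.-integrable setT (EFin \o U) ->
  P.-integrable setT (EFin \o (U \* V)) ->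
  (\int[P]_w (U w)%:E = 0 -> \int[P]_w (U w * V w)%:E = 0)%E.
Proof.
move=> UV iU iUV U0.
pose phi (w : Omega) : R * R := (U w, V w).
have mphi : measurable_fun setT phi by exact: measurable_fun_pair.
pose W : {RV P >-> (R * R)%type} := HB.pack phi (isMeasurableFun.Build _ _ _ _ _ mphi).
have E X : measurable X -> (distribution P U \x distribution P V)%E X = distribution P W X.
  apply: product_measure_unique => A B mA mB.
  by rewrite /distribution/= /pushforward/= -UV.
pose g (z : R * R) : R := z.1 * z.2.
have mg : measurable_fun setT g by exact: measurable_funM.
pose f := EFin \o g.
have mf : measurable_fun setT f by exact/measurable_EFinP.
transitivity (\int[distribution P W]_z f z)%E.
  by rewrite integral_distribution.
rewrite (eq_measure_integral (distribution P U \x distribution P V)%E); last first.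
  by move=> A mA _; exact: esym (E _ mA).
have iU' : (distribution P U).-integrable setT (EFin \o id).
  apply/integrableP; split; first exact/measurable_EFinP.
  rewrite ge0_integral_distribution//=.
    by case/integrableP: iU.
  by do 2 apply: measurableT_comp => //; exact/measurable_EFinP.
have if' : (distribution P U \x distribution P V)%E.-integrable setT f.
  apply/integrableP; split => //.
  rewrite (eq_measure_integral (distribution P W)); last first.
    by move=> A mA _; exact: (E _ mA).
  rewrite ge0_integral_distribution//=.
    by case/integrableP: iUV.
  by apply/measurable_EFinP; exact: measurableT_comp.
rewrite -integral21_prod_meas1// /fubini_G.
rewrite (eq_integral (cst 0%E)) ?integral0// => y _.
transitivity (\int[distribution P U]_x (y%:E * (EFin \o id) x))%E.
  by apply: eq_integral => x _; rewrite /f/= /g/= EFinM muleC.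
rewrite (integralZl measurableT iU') (_ : integral _ _ _ = 0%E) ?mule0//.
rewrite -[RHS]U0; exact: (@integral_distribution _ _ _ _ _ P U EFin).
Qed.

(** Having [setT] in each system makes the product formula cover all subfamilies, and closure under
    intersection allows passing to generated sigma-algebras. *)
Definition indep_systems (n : nat) (F : 'I_n -> set (set Omega)) : Prop :=
  [/\ forall i, F i `<=` measurable, forall i, setI_closed (F i),
      forall i, F i setT &
      forall E : 'I_n -> set Omega, (forall i, F i (E i)) ->
        P (\bigcap_i E i) = (\prod_(i < n) P (E i))%E].

(** A pi-system generating the information carried by the indices below [j]. *)
Definition prefix_system (n : nat) (F : 'I_n -> set (set Omega)) (j : nat) :
    set (set Omega) :=
  [set C | exists E : 'I_n -> set Omega, [/\ forall i, F i (E i),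
    forall i : 'I_n, (j <= i)%N -> E i = setT & C = \bigcap_i E i]].

Lemma prefix_system_measurable n (F : 'I_n -> set (set Omega)) j :
  (forall i, F i `<=` measurable) -> prefix_system F j `<=` measurable.
Proof.
move=> Fm _ [E [FE _ ->]]; apply: fin_bigcap_measurable => // i _; exact: Fm.
Qed.

(** Both sides are finite measures in [C]. They agree on the pi-system [prefix_system F j], hence on
    the sigma-algebra it generates. *)
Lemma indep_prefix n (F : 'I_n -> set (set Omega)) (j : 'I_n) C D :
  indep_systems F -> <<s prefix_system F j >> C -> F j D ->
  P (D `&` C) = (P D * P C)%E.
Proof.
move=> [Fm FI FT Fi] sC FD.
have mD := Fm _ _ FD.
have PDfin : P D \is a fin_num by exact: fin_num_measure.
have PD0 : 0 <= fine (P D) by exact: fine_ge0.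
transitivity (mscale (NngNum PD0) P C); last by rewrite /mscale/= fineK.
rewrite setIC -[LHS]/(mrestr P mD C).
apply: (g_sigma_algebra_measure_unique (prefix_system F j)
  (prefix_system_measurable Fm) (fun=> setT)) => //.
- by move=> _; exists (fun=> setT); split=> //; rewrite bigcapT.
- by rewrite bigcup_const.
- move=> A B [EA [FA TA ->]] [EB [FB TB ->]].
  exists (fun i => EA i `&` EB i); split.
  + by move=> i; exact: FI.
  + by move=> i ji; rewrite TA// TB// setIT.
  + by rewrite bigcapI.
- move=> _ [E [FE TE ->]]; change (P (\bigcap_i E i `&` D) = (fine (P D))%:E * P (\bigcap_i E i))%E.
  rewrite fineK//.
  (* The slot [j] of a prefix event is [setT], so [D] can be put there and the product formula
     applied once more. *)
  pose E' i := if i == j then D else E i.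
  rewrite Fi// (bigD1 j)//= TE// probability_setT mul1e.
  transitivity (P (\bigcap_i E' i)).
    congr (P _); apply/seteqP; split=> w /=.
      by move=> [Ew Dw] i _; rewrite /E'; case: eqP => [_//|_]; exact: Ew.
    move=> E'w; split; last by have := E'w j I; rewrite /E' eqxx.
    move=> i _; have := E'w i I; rewrite /E'; case: eqP => // -> _.
    by rewrite TE.
  rewrite Fi; last by move=> i; rewrite /E'; case: eqP => [->|].
  rewrite (bigD1 j)//= /E' eqxx; congr (_ * _)%E.
  by apply: eq_bigr => i /negPf ->.
- move=> _; change (P (setT `&` D) < +oo)%E.
  by rewrite setTI (le_lt_trans (probability_le1 _ _))// ltry.
Qed.

End independence.

(** * Pinelis' inequality in finite dimension *)

Lemma discriminant_le {R : realType} (A B C : R) : 0 <= B ->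
  (forall t, 0 <= A + 2 * t * C + t ^+ 2 * B) -> C ^+ 2 <= A * B.
Proof.
move=> B0 h; have [B00|Bn0] := eqVneq B 0.
  have [->|C0] := eqVneq C 0; first by rewrite B00 mulr0 expr0n.
  (* With [B = 0] the expression is affine in [t]; this argument gives it the value [-1]. *)
  have := h (- (A + 1) / (2 * C)).
  rewrite B00 mulr0 addr0 (_ : _ + _ = -1); last by field.
  by rewrite ler0N1.
have Bp : 0 < B by rewrite lt0r Bn0.
have := h (- C / B).
rewrite (_ : _ + _ = (A * B - C ^+ 2) / B); last by field.
by rewrite pmulr_lge0 ?invr_gt0// subr_ge0.
Qed.

Lemma cauchy_schwarz_sum {R : realType} (I : Type) (s : seq I) (a b : I -> R) :
  `|\sum_(i <- s) a i * b i| <=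
  Num.sqrt (\sum_(i <- s) a i ^+ 2) * Num.sqrt (\sum_(i <- s) b i ^+ 2).
Proof.
rewrite -sqrtrM ?sumr_ge0//; last by move=> i _; exact: sqr_ge0.
rewrite -sqrtr_sqr ler_wsqrtr//; apply: discriminant_le.
  by apply: sumr_ge0 => i _; exact: sqr_ge0.
move=> t; rewrite !mulr_sumr -!big_split/=; apply: sumr_ge0 => i _.
rewrite (_ : _ + _ = (a i + t * b i) ^+ 2) ?sqr_ge0//; ring.
Qed.

Section measurable_extra.
Context {R : realType}.

(** Squaring makes the argument nonnegative, where the real power [-1] is the inverse; the factor
    [x] restores the sign, and both sides are 0 at 0. *)
Lemma measurable_invr : measurable_fun [set: R] (@GRing.inv R).
Proof.
rewrite (_ : @GRing.inv R = (fun x => x * ((x ^+ 2) `^ (-1)))); last first.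
  apply/funext => x; rewrite powR_inv1 ?sqr_ge0//.
  by have [->|x0] := eqVneq x 0; [rewrite invr0 mul0r|field].
apply: measurable_funM => //.
apply: (measurableT_comp (f := fun x => x `^ (-1))).
  exact: measurable_powR.
exact: exprn_measurable.
Qed.

Lemma measurable_sqrt : measurable_fun [set: R] (@Num.sqrt R).
Proof. apply: continuous_measurable_fun; exact: sqrt_continuous. Qed.

Lemma measurable_coshR : measurable_fun [set: R] (@coshR R).
Proof.
apply: measurable_funM => //; apply: measurable_funD => //.
apply: (measurableT_comp (f := expR)); first exact: measurable_expR.
exact: oppr_measurable.
Qed.

Lemma measurable_sinhR : measurable_fun [set: R] (@sinhR R).
Proof.
apply: measurable_funM => //; apply: measurable_funB => //.
apply: (measurableT_comp (f := expR)); first exact: measurable_expR.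
exact: oppr_measurable.
Qed.

End measurable_extra.

Section pinelis.
Context {d : measure_display} {Omega : measurableType d} {R : realType}.
Variable P : probability Omega R.
Variables (n K : nat) (F : 'I_n -> set (set Omega)).
Variables (xi : 'I_n -> 'I_K -> Omega -> R) (c : 'I_n -> R).
Hypothesis indepF : indep_systems P F.
Hypothesis xiF : forall i k (B : set R), measurable B -> F i (xi i k @^-1` B).
Hypothesis c_ge0 : forall i, 0 <= c i.
Hypothesis xi_le : forall i w, \sum_(k < K) xi i k w ^+ 2 <= c i ^+ 2.
Hypothesis xi_mean0 : forall i k, (\int[P]_w (xi i k w)%:E = 0)%E.

Let S (j : nat) (k : 'I_K) (w : Omega) : R := \sum_(i < n | (i < j)%N) xi i k w.
Let N (j : nat) (w : Omega) : R := Num.sqrt (\sum_(k < K) S j k w ^+ 2).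

Let xi_bound i k w : `|xi i k w| <= c i.
Proof.
rewrite -(@ler_pXn2r _ 2) ?nnegrE// real_normK ?num_real//.
rewrite (le_trans _ (xi_le i w))// (bigD1 k)//= lerDl sumr_ge0// => l _.
exact: sqr_ge0.
Qed.

Let M := Num.sqrt (\sum_(k < K) (\sum_(i < n) c i) ^+ 2).

Let S_bound j k w : `|S j k w| <= \sum_(i < n) c i.
Proof.
rewrite (le_trans (ler_norm_sum _ _ _))// big_mkcond/= ler_sum// => i _.
by case: ifP => // _.
Qed.

Let N_bound j w : N j w <= M.
Proof.
rewrite ler_wsqrtr// ler_sum// => k _.
rewrite -[leLHS]real_normK ?num_real// lerXn2r ?nnegrE//.
exact: sumr_ge0.
Qed.

Let S_le_N j k w : `|S j k w| <= N j w.
Proof.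
rewrite -sqrtr_sqr ler_wsqrtr// (bigD1 k)//= lerDl sumr_ge0// => l _.
exact: sqr_ge0.
Qed.

Let N_ge0 j w : 0 <= N j w. Proof. exact: sqrtr_ge0. Qed.

(** A copy of [Omega] carrying the sigma-algebra of the first [j] systems, so that dependence on the
    past alone can be stated as measurability. *)
Let past j := g_sigma_algebraType (prefix_system F j).

Let measurable_xi_past (j : nat) (i : 'I_n) k : (i < j)%N ->
  measurable_fun [set: past j] (xi i k : past j -> R).
Proof.
move=> ij _ B mB; rewrite setTI; apply: sub_sigma_algebra.
have [_ _ FT _] := indepF.
exists (fun l => if l == i then xi i k @^-1` B else setT); split.
- by move=> l; case: eqP => [->|_//]; exact: xiF.
- by move=> l jl; case: eqP => // li; move: jl; rewrite li leqNgt ij.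
- apply/seteqP; split=> [w Bw l _|w /(_ i I)]; last by rewrite eqxx.
  by case: eqP.
Qed.

Let measurable_S_past j k : measurable_fun [set: past j] (S j k : past j -> R).
Proof.
rewrite (_ : S j k = (fun w => \sum_(i < n) (if (i < j)%N then xi i k w else 0))).
  apply: measurable_sum => i; case: (ltnP i j) => ij; last exact: measurable_cst.
  exact: measurable_xi_past.
by apply/funext => w; rewrite /S big_mkcond.
Qed.

Let measurable_N_past j : measurable_fun [set: past j] (N j : past j -> R).
Proof.
apply: (measurableT_comp measurable_sqrt); apply: measurable_sum => k.
by apply: measurable_funX; exact: measurable_S_past.
Qed.

Let past_measurable j (A : set Omega) : (measurable : set (set (past j))) A -> measurable A.
Proof.
have [Fm _ _ _] := indepF; move: A.
apply: smallest_sub; first exact: sigma_algebra_measurable.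
exact: prefix_system_measurable.
Qed.

Let past_measurable_fun j (f : Omega -> R) :
  measurable_fun [set: past j] (f : past j -> R) -> measurable_fun [set: Omega] f.
Proof. by move=> mf _ B mB; apply: (@past_measurable j); exact: mf. Qed.

Let measurable_xi i k : measurable_fun [set: Omega] (xi i k).
Proof. by apply: (@past_measurable_fun i.+1); exact: measurable_xi_past. Qed.

Variable lam : R.
Hypothesis lam_gt0 : 0 < lam.

(** The factor multiplying [xi j k] in the chord bound, up to a constant. It depends on the past
    only, and is 0 where [N j] vanishes. *)
Let G j k (w : Omega) : R := S j k w * (sinhR (lam * N j w) * (lam * N j w)^-1).

Let measurable_G_past j k : measurable_fun [set: past j] (G j k : past j -> R).
Proof.
have mN : measurable_fun [set: past j] ((fun w => lam * N j w) : past j -> R).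
  by apply: measurable_funM; [exact: measurable_cst|exact: measurable_N_past].
apply: measurable_funM; first exact: measurable_S_past.
apply: measurable_funM; first exact: (measurableT_comp measurable_sinhR mN).
exact: (measurableT_comp measurable_invr mN).
Qed.

(** From [S_le_N], the quotient of [S j k] by [lam * N j] is at most [lam^-1] in absolute value;
    moreover [sinhR] is dominated by [coshR]. *)
Let G_bound j k w : `|G j k w| <= lam^-1 * coshR (lam * M).
Proof.
rewrite /G mulrCA normrM [X in _ * X]normrM mulrC ler_pM ?mulr_ge0//.
- have [N0|N0] := eqVneq (N j w) 0.
    by rewrite N0 mulr0 invr0 normr0 mulr0 invr_ge0 ltW.
  have Np : 0 < N j w by rewrite lt0r N0/=.
  rewrite invfM normrM mulrCA (gtr0_norm (_ : 0 < lam^-1)) ?invr_gt0//.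
  apply: ler_piMr; first by rewrite invr_ge0 ltW.
  rewrite [X in _ * X]ger0_norm ?invr_ge0//.
  by rewrite ler_pdivrMr// mul1r.
- apply: (@le_trans _ _ (coshR (lam * N j w))).
    rewrite /sinhR /coshR normrM [`|2^-1|]ger0_norm ?invr_ge0// ler_wpM2r ?invr_ge0//.
    by rewrite (le_trans (ler_normB _ _))// !ger0_norm ?expR_ge0.
  by rewrite coshR_le ?mulr_ge0 ?(ltW lam_gt0)// ler_pM2l.
Qed.

(** The martingale-difference property: [G j k] is measurable with respect to the past, which is
    independent of the centred [xi j k]. *)
Let mean_xi_G (j : 'I_n) k : (\int[P]_w (xi j k w * G j k w)%:E = 0)%E.
Proof.
have mU := measurable_xi j k.
have mV : measurable_fun [set: Omega] (G j k).
  by apply: (@past_measurable_fun j); exact: measurable_G_past.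
pose U : {RV P >-> R} := HB.pack (xi j k) (isMeasurableFun.Build _ _ _ _ _ mU).
pose V : {RV P >-> R} := HB.pack (G j k) (isMeasurableFun.Build _ _ _ _ _ mV).
apply: (integralM_indep (U := U) (V := V)) => //.
- move=> A B mA mB; apply: (indep_prefix indepF); last exact: xiF.
  by have := @measurable_G_past j k measurableT _ mB; rewrite setTI.
- by apply: (@bounded_integrable _ _ _ P _ (c j)); [exact: mU|exact: xi_bound].
- apply: (@bounded_integrable _ _ _ P _ (c j * (lam^-1 * coshR (lam * M)))).
    exact: measurable_funM.
  by move=> w; rewrite /= normrM ler_pM.
- exact: xi_mean0.
Qed.

Let integrable_cosh j : P.-integrable setT (EFin \o (fun w => coshR (lam * N j w))).
Proof.
apply: (@bounded_integrable _ _ _ P _ (coshR (lam * M))).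
  apply: (measurableT_comp measurable_coshR); apply: measurable_funM => //.
  by apply: (@past_measurable_fun j); exact: measurable_N_past.
move=> w; rewrite ger0_norm ?coshR_ge0// coshR_le ?mulr_ge0 ?(ltW lam_gt0)//.
by rewrite ler_pM2l.
Qed.

Let S_S (j : 'I_n) k w : S j.+1 k w = S j k w + xi j k w.
Proof.
rewrite /S (bigD1 j)//= addrC; congr (_ + _); apply: eq_bigl => i.
by rewrite ltnS [(i < j)%N]ltn_neqAle andbC.
Qed.

Let cosh_step (j : 'I_n) w : coshR (lam * N j.+1 w) <=
  coshR (lam * c j) * coshR (lam * N j w) +
  \sum_(k < K) (lam ^+ 2 * (sinhR (lam * c j) * (lam * c j)^-1)) *
     (xi j k w * G j k w).
Proof.
have lam0 := ltW lam_gt0.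
(* The scaled inner product of the partial sum and the new term. Cauchy-Schwarz bounds it by
   [(lam * N j w) * (lam * c j)], as [coshR_step] requires. *)
pose t := lam ^+ 2 * \sum_(k < K) S j k w * xi j k w.
have := @coshR_step R (lam * N j w) (lam * c j) t (lam * N j.+1 w).
move=> /(_ _ _ _ _ _)/le_trans; apply; rewrite ?mulr_ge0//.
- rewrite normrM (ger0_norm (sqr_ge0 _)) expr2 mulrACA ler_pM ?mulr_ge0//.
  rewrite (le_trans (cauchy_schwarz_sum _ _ _))// ler_pM ?sqrtr_ge0//.
  by rewrite -[leRHS]ger0_norm// -sqrtr_sqr ler_wsqrtr.
- rewrite !exprMn /t.
  rewrite (mulrCA 2) -!mulrDr ler_pM2l ?exprn_gt0//.
  rewrite /N !sqr_sqrtr ?sumr_ge0//; try by move=> k _; exact: sqr_ge0.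
  rewrite addrAC -(lerD2r (- c j ^+ 2)) addrK.
  rewrite (_ : \sum_(k < K) S j.+1 k w ^+ 2 = \sum_(k < K) S j k w ^+ 2 +
    2 * (\sum_(k < K) S j k w * xi j k w) + \sum_(k < K) xi j k w ^+ 2); last first.
    rewrite mulr_sumr -!big_split/=; apply: eq_bigr => k _.
    by rewrite S_S; ring.
  by rewrite -addrA gerDl subr_le0.
- rewrite mulrC lerD2l /t le_eqVlt; apply/orP; left; apply/eqP.
  rewrite mulr_sumr !mulr_suml; apply: eq_bigr => k _; rewrite /G; ring.
Qed.

(** Integrating [cosh_step] removes the linear term by [mean_xi_G], so each summand costs one factor
    [coshR (lam * c j)]. *)
Let integral_cosh_step (j : 'I_n) :
  \int[P]_w coshR (lam * N j.+1 w) <= coshR (lam * c j) * \int[P]_w coshR (lam * N j w).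
Proof.
pose C := lam ^+ 2 * (sinhR (lam * c j) * (lam * c j)^-1).
have ixG k : P.-integrable setT (EFin \o (fun w => xi j k w * G j k w)).
  apply: (@bounded_integrable _ _ _ P _ (c j * (lam^-1 * coshR (lam * M)))).
    apply: measurable_funM => //.
    by apply: (@past_measurable_fun j); exact: measurable_G_past.
  by move=> w; rewrite normrM ler_pM.
have iCxG k : P.-integrable setT (EFin \o (fun w => C * (xi j k w * G j k w))).
  exact: (integrableZl measurableT _ (ixG k)).
have isum : P.-integrable setT
    (EFin \o (fun w => \sum_(k < K) C * (xi j k w * G j k w))).
  rewrite (_ : _ \o _ = (fun w => \sum_(k < K) (C * (xi j k w * G j k w))%:E)%E).
    by apply: integrable_sum => // k _; exact: iCxG.
  by apply/funext => w; rewrite /= sumEFin.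
have iC : P.-integrable setT
    (EFin \o (fun w => coshR (lam * c j) * coshR (lam * N j w))).
  exact: (integrableZl measurableT _ (integrable_cosh j)).
apply: (@le_trans _ _ (\int[P]_w (coshR (lam * c j) * coshR (lam * N j w) +
  \sum_(k < K) C * (xi j k w * G j k w)))).
  apply: le_Rintegral => //.
  by rewrite (_ : _ \o _ = (EFin \o (fun w => coshR (lam * c j) * coshR (lam * N j w))) \+
      (EFin \o (fun w => \sum_(k < K) C * (xi j k w * G j k w)))) //; exact: integrableD.
rewrite RintegralD// RintegralZl// Rintegral_sum// big1 ?addr0// => k _.
by rewrite RintegralZl// /Rintegral mean_xi_G mulr0.
Qed.

Let integral_cosh (j : nat) : (j <= n)%N ->
  \int[P]_w coshR (lam * N j w) <= \prod_(i < n | (i < j)%N) coshR (lam * c i).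
Proof.
elim: j => [_|j ih jn].
  rewrite (_ : (fun w => _) = (fun=> 1)).
    by rewrite Rintegral_cst//= mul1r probability_setT/= big1.
  apply/funext => w; rewrite /N big1 ?sqrtr0 ?mulr0 ?coshR0// => k _.
  by rewrite /S big1 ?expr0n.
rewrite (le_trans (integral_cosh_step (Ordinal jn)))// (bigD1 (Ordinal jn))//=.
rewrite ler_wpM2l ?coshR_ge0// (le_trans (ih (ltnW jn)))//.
rewrite le_eqVlt; apply/orP; left; apply/eqP; apply: eq_bigl => i.
by rewrite ltnS [(i < j)%N]ltn_neqAle andbC -val_eqE.
Qed.

Let sum_xi : (fun w => coshR (lam * N n w)) =
  (fun w => coshR (lam * Num.sqrt (\sum_(k < K) (\sum_(i < n) xi i k w) ^+ 2))).
Proof.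
apply/funext => w; congr (coshR (lam * Num.sqrt _)).
apply: eq_bigr => k _; congr (_ ^+ 2); apply: eq_bigl => i; exact: ltn_ord.
Qed.

Lemma integrable_cosh_norm : P.-integrable setT (EFin \o
  (fun w => coshR (lam * Num.sqrt (\sum_(k < K) (\sum_(i < n) xi i k w) ^+ 2)))).
Proof. by rewrite -sum_xi; exact: integrable_cosh. Qed.

Lemma integral_cosh_norm :
  \int[P]_w coshR (lam * Num.sqrt (\sum_(k < K) (\sum_(i < n) xi i k w) ^+ 2)) <=
  expR (lam ^+ 2 * (\sum_(i < n) c i ^+ 2) / 2).
Proof.
rewrite -sum_xi.
rewrite (le_trans (integral_cosh (leqnn n)))//.
rewrite (eq_bigl predT); last by move=> i; rewrite ltn_ord.
rewrite mulr_sumr mulr_suml expR_sum; apply: ler_prod => i _.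
by rewrite coshR_ge0/= -exprMn coshR_expR.
Qed.

Lemma measurable_norm_sum : measurable_fun [set: Omega]
  (fun w => Num.sqrt (\sum_(k < K) (\sum_(i < n) xi i k w) ^+ 2)).
Proof.
apply: (measurableT_comp measurable_sqrt); apply: measurable_sum => k.
by apply: measurable_funX; apply: measurable_sum => i.
Qed.

End pinelis.

Lemma pinelis_tail {d : measure_display} {Omega : measurableType d} {R : realType}
  (P : probability Omega R) (n K : nat) (F : 'I_n -> set (set Omega))
  (xi : 'I_n -> 'I_K -> Omega -> R) (c : 'I_n -> R) (delta b : R) :
  indep_systems P F ->
  (forall i k (B : set R), measurable B -> F i (xi i k @^-1` B)) ->
  (forall i, 0 <= c i) ->
  (forall i w, \sum_(k < K) xi i k w ^+ 2 <= c i ^+ 2) ->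
  (forall i k, (\int[P]_w (xi i k w)%:E = 0)%E) ->
  0 < delta -> 0 <= b -> \sum_(i < n) c i ^+ 2 <= b ^+ 2 ->
  (P [set w | (delta * b < Num.sqrt (\sum_(k < K) (\sum_(i < n) xi i k w) ^+ 2))%R]
   <= (2 * expR (- (delta ^+ 2) / 2))%:E)%E.
Proof.
move=> indepF xiF c0 xic xi0 d0 b0 cb.
pose N w := Num.sqrt (\sum_(k < K) (\sum_(i < n) xi i k w) ^+ 2).
(* If [b = 0] all summands vanish and the strict inequality makes the event empty; otherwise
   division by [b] is meaningful. *)
have [b00|bn0] := eqVneq b 0.
  have ci i : c i = 0.
    apply/eqP; rewrite -sqrf_eq0 eq_le sqr_ge0 andbT.
    have : \sum_(i < n) c i ^+ 2 <= 0 by rewrite (le_trans cb)// b00 expr0n.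
    apply: le_trans; rewrite (bigD1 i)//= lerDl sumr_ge0// => l _; exact: sqr_ge0.
  have xi00 i k w : xi i k w = 0.
    apply/eqP; rewrite -sqrf_eq0 eq_le sqr_ge0 andbT.
    have : \sum_(k < K) xi i k w ^+ 2 <= 0 by rewrite (le_trans (xic _ _))// ci expr0n.
    apply: le_trans; rewrite (bigD1 k)//= lerDl sumr_ge0// => l _; exact: sqr_ge0.
  rewrite (_ : [set w | _] = set0) ?measure0 ?lee_fin ?mulr_ge0 ?expR_ge0//.
  apply/seteqP; split=> // w /=; rewrite b00 mulr0 big1 ?sqrtr0 ?ltxx// => k _.
  by rewrite big1 ?expr0n.
have bp : 0 < b by rewrite lt0r bn0.
(* This minimises [lam ^+ 2 * b ^+ 2 / 2 - lam * delta * b], with minimum [- delta ^+ 2 / 2]. *)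
pose lam := delta / b.
have lam0 : 0 < lam by rewrite divr_gt0.
have icosh := integral_cosh_norm indepF xiF c0 xic xi0 lam0.
have mN : measurable_fun setT N.
  exact: (measurable_norm_sum indepF xiF).
set A := [set w | _].
have mA : measurable A.
  rewrite (_ : A = N @^-1` `]delta * b, +oo[%classic).
    by rewrite -[X in measurable X]setTI; apply: mN.
  by apply/seteqP; split=> w /=; rewrite in_itv/= andbT.
have PAfin : P A \is a fin_num by exact: fin_num_measure.
rewrite -(fineK PAfin) lee_fin.
have cosh_r : expR (delta ^+ 2) / 2 <= coshR (lam * (delta * b)).
  rewrite /lam (_ : delta / b * (delta * b) = delta ^+ 2); last by field.
  by rewrite ler_pM2r ?invr_gt0// lerDl expR_ge0.
have le1 : fine (P A) * (expR (delta ^+ 2) / 2) <= expR (delta ^+ 2 / 2).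
  apply: (@le_trans _ _ (\int[P]_w coshR (lam * N w))); last first.
    rewrite (le_trans icosh)// ler_expR ler_pM2r ?invr_gt0// /lam.
    rewrite expr_div_n mulrAC ler_pdivrMr ?exprn_gt0// ler_pM2l// exprn_gt0//.
  (* Markov's inequality by hand: the left side is the integral of a constant over [A], where
     [coshR] exceeds that constant. *)
  rewrite mulrC -(Rintegral_cst _ mA) Rintegral_mkcond.
  apply: le_Rintegral => //.
  - apply: (@bounded_integrable _ _ _ P _ (expR (delta ^+ 2) / 2)).
      by apply/(measurable_restrictT _ mA); exact: measurable_cst.
    move=> w; rewrite patchE; case: ifP => _; last by rewrite normr0 divr_ge0 ?expR_ge0.
    by rewrite ger0_norm// divr_ge0 ?expR_ge0.
  - exact: (integrable_cosh_norm indepF xiF c0 xic lam0).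
  - move=> w _; rewrite patchE; case: ifPn => [|_]; last exact: coshR_ge0.
    rewrite inE => Aw; rewrite (le_trans cosh_r)// coshR_le//.
      by rewrite (mulr_ge0 (ltW lam0))// (mulr_ge0 (ltW d0)).
    by rewrite ler_pM2l// ltW.
have -> : 2 * expR (- (delta ^+ 2) / 2) = expR (delta ^+ 2 / 2) / (expR (delta ^+ 2) / 2).
  rewrite mulNr expRN.
  have -> : expR (delta ^+ 2) = expR (delta ^+ 2 / 2) * expR (delta ^+ 2 / 2).
    by rewrite -expRD; congr expR; lra.
  by field; rewrite gt_eqF ?expR_gt0.
by rewrite ler_pdivlMr// divr_gt0 ?expR_gt0.
Qed.

(** * The space L2 *)

Section L2.
Context {R : realType} (mu : {measure set (measurableTypeR R) -> \bar R}).
Implicit Types f g h : R -> R.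
Local Notation L2 := (memL2 mu).
Local Notation "<| f , g |>" := (innerH mu f g).
Local Notation normH := (normH mu).

(** The product is dominated by [f ^+ 2 + g ^+ 2], because the squares of [f + g] and [f - g] are
    nonnegative. *)
Lemma memL2_integrable f g : L2 f -> L2 g ->
  mu.-integrable setT (EFin \o (fun x => f x * g x)).
Proof.
move=> [mf f2] [mg g2].
have i2 h : measurable_fun setT h -> (\int[mu]_x ((h x) ^+ 2)%:E < +oo)%E ->
    mu.-integrable setT (EFin \o (fun x => h x ^+ 2)).
  move=> mh h2; apply/integrableP; split.
    by apply/measurable_EFinP; exact: measurable_funX.
  by under eq_integral do rewrite /= ger0_norm ?sqr_ge0//.
apply: (@le_integrable _ _ _ mu _ measurableT _
  ((EFin \o (fun x => f x ^+ 2)) \+ (EFin \o (fun x => g x ^+ 2)))).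
- by apply/measurable_EFinP; exact: measurable_funM.
- move=> x _ /=; rewrite lee_fin [leRHS]ger0_norm ?addr_ge0 ?sqr_ge0//.
  rewrite ler_norml; apply/andP; split.
  + by have := sqr_ge0 (f x + g x); have := sqr_ge0 (f x); have := sqr_ge0 (g x); lra.
  + by have := sqr_ge0 (f x - g x); have := sqr_ge0 (f x); have := sqr_ge0 (g x); lra.
- by apply: integrableD => //; exact: i2.
Qed.

Lemma memL2_0 : L2 (fun=> 0).
Proof.
split; first exact: measurable_cst.
by rewrite (eq_integral (cst 0%E)) ?integral0// => x _; rewrite expr0n.
Qed.

Lemma memL2D f g : L2 f -> L2 g -> L2 (fun x => f x + g x).
Proof.
move=> Lf Lg; split; first exact: measurable_funD Lf.1 Lg.1.
have : mu.-integrable setT ((EFin \o (fun x => f x * f x)%R) \+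
    ((fun x => 2%:E * (EFin \o (fun x => f x * g x)%R) x) \+
     (EFin \o (fun x => g x * g x)%R)))%E.
  apply: integrableD => //; first exact: memL2_integrable.
  apply: integrableD => //; last exact: memL2_integrable.
  by apply: integrableZl => //; exact: memL2_integrable.
move=> /integrableP[_]; apply: le_lt_trans.
rewrite le_eqVlt; apply/orP; left; apply/eqP.
apply: eq_integral => x _ /=; congr (_%:E).
by rewrite -[LHS]ger0_norm ?sqr_ge0//; congr (`|_|); ring.
Qed.

Lemma memL2Z (k : R) f : L2 f -> L2 (fun x => k * f x).
Proof.
move=> Lf; split; first by apply: measurable_funM => //; exact: Lf.1.
have : mu.-integrable setT (fun x => (k ^+ 2)%:E * (EFin \o (fun x => f x * f x)%R) x)%E.
  by apply: integrableZl => //; exact: memL2_integrable.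
move=> /integrableP[_]; apply: le_lt_trans.
rewrite le_eqVlt; apply/orP; left; apply/eqP.
apply: eq_integral => x _ /=; congr (_%:E).
by rewrite -[LHS]ger0_norm ?sqr_ge0//; congr (`|_|); ring.
Qed.

Lemma memL2B f g : L2 f -> L2 g -> L2 (fun x => f x - g x).
Proof.
move=> Lf /(memL2Z (-1)) Lg; rewrite (_ : (fun x => _) = (fun x => f x + -1 * g x)).
  exact: memL2D.
by apply/funext => x; rewrite mulN1r.
Qed.

Lemma memL2_sum (I : Type) (s : seq I) (F : I -> R -> R) :
  (forall i, L2 (F i)) -> L2 (fun x => \sum_(i <- s) F i x).
Proof.
move=> LF; elim: s => [|i s ih].
  rewrite (_ : (fun x => _) = (fun=> 0)); first exact: memL2_0.
  by apply/funext => x; rewrite big_nil.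
rewrite (_ : (fun x => _) = (fun x => F i x + \sum_(i <- s) F i x)).
  exact: memL2D.
by apply/funext => x; rewrite big_cons.
Qed.

Lemma innerHC f g : <|f, g|> = <|g, f|>.
Proof. by congr fine; apply: eq_integral => x _; rewrite mulrC. Qed.

Lemma innerHDl f g h : L2 f -> L2 g -> L2 h ->
  <|(fun x => f x + g x), h|> = <|f, h|> + <|g, h|>.
Proof.
move=> Lf Lg Lh.
transitivity (\int[mu]_x (f x * h x + g x * h x)).
  by congr fine; apply: eq_integral => x _; rewrite mulrDl.
by rewrite RintegralD//; exact: memL2_integrable.
Qed.

Lemma innerHDr f g h : L2 f -> L2 g -> L2 h ->
  <|h, (fun x => f x + g x)|> = <|h, f|> + <|h, g|>.
Proof. by move=> *; rewrite innerHC innerHDl// !(innerHC h). Qed.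

Lemma innerHZl (k : R) f h : L2 f -> L2 h ->
  <|(fun x => k * f x), h|> = k * <|f, h|>.
Proof.
move=> Lf Lh; transitivity (\int[mu]_x (k * (f x * h x))).
  by congr fine; apply: eq_integral => x _; rewrite mulrA.
by rewrite RintegralZl//; exact: memL2_integrable.
Qed.

Lemma innerH_suml (I : Type) (s : seq I) (F : I -> R -> R) h :
  (forall i, L2 (F i)) -> L2 h ->
  <|(fun x => \sum_(i <- s) F i x), h|> = \sum_(i <- s) <|F i, h|>.
Proof.
move=> LF Lh; transitivity (\int[mu]_x (\sum_(i <- s) F i x * h x)).
  by congr fine; apply: eq_integral => x _; rewrite mulr_suml.
by rewrite Rintegral_sum// => i; exact: memL2_integrable.
Qed.

Lemma innerH_ae f f' h : L2 f -> L2 f' -> L2 h ->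
  {ae mu, forall x, f x = f' x} -> <|f, h|> = <|f', h|>.
Proof.
move=> Lf Lf' Lh ff'; congr fine; apply: ae_eq_integral => //.
- by case/integrableP: (memL2_integrable Lf Lh).
- by case/integrableP: (memL2_integrable Lf' Lh).
- by move: ff'; apply: (@filterS _ _ (ae_filter_ringOfSetsType mu)) => x /= -> _.
Qed.

Lemma innerH_ge0 f : 0 <= <|f, f|>.
Proof.
by apply: Rintegral_ge0 => x _; rewrite -expr2 sqr_ge0.
Qed.

Lemma normH_ge0 f : 0 <= normH f. Proof. exact: sqrtr_ge0. Qed.

Lemma normH_sq f : normH f ^+ 2 = <|f, f|>.
Proof. by rewrite sqr_sqrtr// innerH_ge0. Qed.

Lemma normH_ae f f' : L2 f -> L2 f' -> {ae mu, forall x, f x = f' x} ->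
  normH f = normH f'.
Proof.
move=> Lf Lf' ff'; rewrite /Defs.normH; congr Num.sqrt.
by rewrite (innerH_ae Lf Lf' Lf ff') innerHC (innerH_ae Lf Lf' Lf' ff').
Qed.

Lemma normHZ (k : R) f : L2 f -> normH (fun x => k * f x) = `|k| * normH f.
Proof.
move=> Lf; have Lkf := memL2Z k Lf.
rewrite /Defs.normH innerHZl// innerHC innerHZl// mulrA -expr2.
by rewrite sqrtrM ?sqr_ge0// sqrtr_sqr.
Qed.

Lemma normHD_sq f g : L2 f -> L2 g ->
  normH (fun x => f x + g x) ^+ 2 = normH f ^+ 2 + 2 * <|f, g|> + normH g ^+ 2.
Proof.
move=> Lf Lg; have LD := memL2D Lf Lg.
rewrite !normH_sq innerHDl// !innerHDr//.
by rewrite (innerHC g f); ring.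
Qed.

Lemma innerH_cauchy_schwarz f g : L2 f -> L2 g -> `|<|f, g|>| <= normH f * normH g.
Proof.
move=> Lf Lg; rewrite -sqrtrM ?innerH_ge0// -sqrtr_sqr ler_wsqrtr//.
apply: discriminant_le; first exact: innerH_ge0.
move=> t; have Ltg := memL2Z t Lg.
have := sqr_ge0 (normH (fun x => f x + t * g x)).
rewrite normHD_sq// normHZ// exprMn real_normK ?num_real// !normH_sq.
by rewrite (innerHC f) innerHZl// (innerHC g f) mulrA.
Qed.

Lemma normHD f g : L2 f -> L2 g -> normH (fun x => f x + g x) <= normH f + normH g.
Proof.
move=> Lf Lg; rewrite -(@ler_pXn2r _ 2) ?nnegrE ?addr_ge0 ?normH_ge0//.
rewrite normHD_sq// sqrrD; have := innerH_cauchy_schwarz Lf Lg.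
by have := ler_norm <|f, g|>; lra.
Qed.

Lemma normH_sum (I : Type) (s : seq I) (F : I -> R -> R) :
  (forall i, L2 (F i)) ->
  normH (fun x => \sum_(i <- s) F i x) <= \sum_(i <- s) normH (F i).
Proof.
move=> LF; elim: s => [|i s ih].
  rewrite big_nil (_ : (fun x => _) = (fun x => 0 * 0)).
    by rewrite (normHZ 0 memL2_0) normr0 mul0r.
  by apply/funext => x; rewrite big_nil mulr0.
rewrite big_cons (_ : (fun x => _) = (fun x => F i x + \sum_(i <- s) F i x)).
  by rewrite (le_trans (normHD _ _))// ?lerD2l//; exact: memL2_sum.
by apply/funext => x; rewrite big_cons.
Qed.

(* Nearest points of a convex set satisfy the obtuse-angle criterion, so the
   projection does not increase distances to points of the set. *)
Lemma projection_nonexpansive y z h : L2 y -> L2 z -> L2 h ->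
  (forall l : R, 0 <= l <= 1 ->
     normH (fun x => z x - h x) <= normH (fun x => l * y x + (1 - l) * z x - h x)) ->
  normH (fun x => y x - z x) <= normH (fun x => y x - h x).
Proof.
move=> Ly Lz Lh hmin.
have Lyz := memL2B Ly Lz; have Lzh := memL2B Lz Lh.
set u := (fun x => y x - z x); set v := (fun x => z x - h x).
have uv0 : 0 <= <|u, v|>.
  rewrite leNgt; apply/negP => uv.
  (* Minimality along the segment from [z] to [y], with the squared norms expanded and a factor [l]
     divided out. *)
  have key (l : R) : 0 < l -> l <= 1 -> - 2 * <|u, v|> <= l * normH u ^+ 2.
    move=> l0 l1; have := hmin l; rewrite (ltW l0) l1 => /(_ erefl).
    rewrite (_ : (fun x => l * y x + _ - _) = (fun x => l * u x + v x)); last first.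
      by apply/funext => x; rewrite /u /v; ring.
    have Llu : L2 (fun x => l * u x) by exact: memL2Z.
    rewrite -(@ler_pXn2r _ 2) ?nnegrE ?normH_ge0// (normHD_sq Llu Lzh).
    rewrite normHZ// innerHZl// exprMn real_normK ?num_real// => h1.
    rewrite -(ler_pM2l l0); lra.
  have un : 0 <= normH u ^+ 2 by rewrite sqr_ge0.
  (* Small enough that [key] would give [- 2 * <|u, v|> <= - <|u, v|> - l], which is absurd when the
     inner product is negative. *)
  pose l := Num.min 1 (- <|u, v|> / (normH u ^+ 2 + 1)).
  have l0 : 0 < l by rewrite lt_min ltr01/= divr_gt0 ?oppr_gt0// ltr_wpDl.
  have l1 : l <= 1 by rewrite ge_min lexx.
  have l2 : l * (normH u ^+ 2 + 1) <= - <|u, v|>.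
    by rewrite -ler_pdivlMr ?ltr_wpDl// ge_min lexx orbT.
  by have := key l l0 l1; lra.
rewrite -(@ler_pXn2r _ 2) ?nnegrE ?normH_ge0//.
rewrite (_ : (fun x => y x - h x) = (fun x => u x + v x)); last first.
  by apply/funext => x; rewrite /u /v; ring.
rewrite (normHD_sq Lyz Lzh) -addrA lerDl; apply: addr_ge0; last exact: sqr_ge0.
exact: mulr_ge0.
Qed.

End L2.

(** * Kernel operators *)

(** Restricting [mu] to the whole space leaves it unchanged and supplies the sigma-finite structure
    that Tonelli's theorem asks for. *)
Lemma finite_sigma_finite {d} {T : measurableType d} {R : realType}
    (mu : {measure set T -> \bar R}) : (mu setT < +oo)%E ->
  exists m : {sigma_finite_measure set T -> \bar R}, (m : {measure set T -> \bar R}) = mu.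
Proof.
move=> muT; exists (mfrestr measurableT muT); apply: eq_measure.
by apply/funext => A; change (mu (A `&` setT) = mu A); rewrite setIT.
Qed.

Section kernel_operator.
Context {R : realType} (mu : {sigma_finite_measure set (measurableTypeR R) -> \bar R}).
Implicit Types (beta : R * R -> R) (f g : R -> R).

(* The line carries two convertible Borel structures, with different displays:
   that of [R] and that of [measurableTypeR R], which the measure uses. *)
Local Notation RR := (measurableTypeR R * measurableTypeR R)%type.

(** Tonelli gives measurability for the positive and negative parts separately, so no integrability
    of the rows is required. *)
Lemma measurable_kerop beta f : measurable_fun setT beta -> measurable_fun setT f ->
  measurable_fun setT (kerop mu beta f).
Proof.
move=> mb mf.
pose F : RR -> \bar R := fun z => (beta z * f z.2)%:E.
have mF : measurable_fun setT F.
  apply/measurable_EFinP; apply: measurable_funM => //.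
  exact: (measurableT_comp (f := f)).
have E : kerop mu beta f = (fun x => fine (\int[mu]_y F^\+ (x, y) - \int[mu]_y F^\- (x, y))%E).
  apply/funext => x; rewrite /kerop /innerH; congr fine; rewrite integralE.
  congr (_ - _)%E; apply: eq_integral => y _.
  - by rewrite !funeposE.
  - by rewrite !funenegE.
rewrite E.
have mE : measurable_fun [set: measurableTypeR R]
    (fun x : measurableTypeR R => (\int[mu]_y F^\+ (x, y) - \int[mu]_y F^\- (x, y))%E).
  apply: emeasurable_funB.
  - by apply: (measurable_fun_fubini_tonelli_F F^\+%E) => //; exact: measurable_funepos.
  - by apply: (measurable_fun_fubini_tonelli_F F^\-%E) => //; exact: measurable_funeneg.
exact: (measurableT_comp (fine_measurable measurableT) mE).
Qed.

Lemma measurable_ker_section beta x : measurable_fun setT beta ->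
  measurable_fun setT (fun y => beta (x, y)).
Proof. by move=> mb; apply: (measurableT_comp mb). Qed.

Let ker_sq beta (z : RR) : \bar R := (beta z ^+ 2)%:E.

Let measurable_ker_sq beta : measurable_fun setT beta -> measurable_fun setT (ker_sq beta).
Proof. by move=> mb; apply/measurable_EFinP; exact: measurable_funX. Qed.

Let ker_sq_ge0 beta z : (0 <= ker_sq beta z)%E.
Proof. by rewrite lee_fin sqr_ge0. Qed.

Let row_sq beta (x : measurableTypeR R) : \bar R := (\int[mu]_y ker_sq beta (x, y))%E.

Let measurable_row_sq beta : measurable_fun setT beta -> measurable_fun setT (row_sq beta).
Proof.
by move=> mb; apply: (measurable_fun_fubini_tonelli_F (ker_sq beta)) => //;
  exact: measurable_ker_sq.
Qed.

Let row_sq_ge0 beta x : (0 <= row_sq beta x)%E.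
Proof. exact: integral_ge0. Qed.

(** [normker2] integrates in the opposite order; Tonelli exchanges the two integrals. *)
Let integral_row_sq beta : memL2ker mu beta ->
  (\int[mu]_x row_sq beta x)%E = (normker2 mu beta)%:E.
Proof.
move=> [mb b2]; rewrite fineK; last first.
  rewrite ge0_fin_numE//; apply: integral_ge0 => y _; apply: integral_ge0 => x _.
  by rewrite lee_fin sqr_ge0.
exact: (fubini_tonelli (ker_sq beta) (measurable_ker_sq mb) (ker_sq_ge0 beta)).
Qed.

(** A finite integral has an almost everywhere finite integrand. Exceptional rows remain possible,
    so linearity of [kerop] is asserted almost everywhere only. *)
Lemma memL2ker_ae beta : memL2ker mu beta ->
  {ae mu, forall x, memL2 mu (fun y => beta (x, y))}.
Proof.
move=> b2; have := integral_row_sq b2; case: b2 => mb _ irow.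
have : mu.-integrable setT (row_sq beta).
  apply/integrableP; split; first exact: measurable_row_sq.
  under eq_integral do rewrite gee0_abs//.
  by rewrite irow ltry.
move=> /integrable_ae => /(_ measurableT).
apply: (@filterS _ _ (ae_filter_ringOfSetsType mu)) => x /= /(_ I) xfin.
split; first exact: measurable_ker_section.
by rewrite -ge0_fin_numE//; exact: row_sq_ge0.
Qed.

Lemma normker2_ge0 beta : 0 <= normker2 mu beta.
Proof.
apply: fine_ge0; apply: integral_ge0 => y _; apply: integral_ge0 => x _.
by rewrite lee_fin sqr_ge0.
Qed.

(** Cauchy-Schwarz on almost every row, then integration over the rows: the Hilbert-Schmidt bound on
    the operator norm. *)
Let integral_kerop_sq beta f : memL2ker mu beta -> memL2 mu f ->
  (\int[mu]_x ((kerop mu beta f x) ^+ 2)%:E <=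
   (normker2 mu beta * normH mu f ^+ 2)%:E)%E.
Proof.
move=> b2 Lf; have mb := b2.1; have mk := measurable_kerop mb Lf.1.
rewrite EFinM -(integral_row_sq b2) -ge0_integralZr//; last 2 first.
- exact: (measurable_row_sq mb).
- by rewrite lee_fin sqr_ge0.
apply: ae_ge0_le_integral => //.
- by move=> x _; rewrite lee_fin sqr_ge0.
- by apply/measurable_EFinP; exact: measurable_funX.
- by move=> x _; rewrite mule_ge0// ?row_sq_ge0// lee_fin sqr_ge0.
- by apply: emeasurable_funM => //; exact: (measurable_row_sq mb).
move: (memL2ker_ae b2); apply: (@filterS _ _ (ae_filter_ringOfSetsType mu)) => x /= Lb _.
have -> : row_sq beta x = (normH mu (fun y => beta (x, y)) ^+ 2)%:E.
  rewrite normH_sq /innerH fineK.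
    by apply: eq_integral => y _; rewrite /ker_sq expr2.
  by apply: integrable_fin_num => //; exact: memL2_integrable.
rewrite -EFinM lee_fin -exprMn -[leLHS]real_normK ?num_real//.
rewrite lerXn2r ?nnegrE ?mulr_ge0 ?normH_ge0//.
exact: innerH_cauchy_schwarz.
Qed.

Lemma memL2_kerop beta f : memL2ker mu beta -> memL2 mu f ->
  memL2 mu (kerop mu beta f).
Proof.
move=> b2 Lf; split; first exact: measurable_kerop b2.1 Lf.1.
exact: le_lt_trans (integral_kerop_sq b2 Lf) (ltry _).
Qed.

Lemma normH_kerop beta f : memL2ker mu beta -> memL2 mu f ->
  normH mu (kerop mu beta f) <= Num.sqrt (normker2 mu beta) * normH mu f.
Proof.
move=> b2 Lf; have Lk := memL2_kerop b2 Lf.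
rewrite -(@ler_pXn2r _ 2) ?nnegrE ?mulr_ge0 ?normH_ge0 ?sqrtr_ge0//.
rewrite exprMn (sqr_sqrtr (normker2_ge0 beta)) (normH_sq mu (kerop mu beta f)) -lee_fin.
rewrite /innerH fineK; last first.
  by apply: integrable_fin_num => //; exact: memL2_integrable.
by under eq_integral do rewrite -expr2; exact: integral_kerop_sq.
Qed.

Lemma keropB_ae beta n (c : 'I_n -> R) f (F : 'I_n -> R -> R) : memL2ker mu beta ->
  memL2 mu f -> (forall j, memL2 mu (F j)) ->
  {ae mu, forall x, kerop mu beta f x - \sum_(j < n) c j * kerop mu beta (F j) x =
    kerop mu beta (fun y => f y - \sum_(j < n) c j * F j y) x}.
Proof.
move=> b2 Lf LF; move: (memL2ker_ae b2).
apply: (@filterS _ _ (ae_filter_ringOfSetsType mu)) => x /= Lb.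
have LcF j : memL2 mu (fun y => c j * F j y) by exact: memL2Z.
rewrite /kerop !(innerHC _ (fun y => beta (x, y))).
rewrite (_ : (fun y => f y - _) = (fun y => f y + -1 * (\sum_(j < n) c j * F j y))).
  rewrite innerHDl//; last by apply: memL2Z; exact: memL2_sum.
  rewrite innerHZl//; last exact: memL2_sum.
  rewrite innerH_suml// mulN1r; congr (_ - _); apply: eq_bigr => j _.
  by rewrite innerHZl// innerHC.
by apply/funext => y; rewrite mulN1r.
Qed.

End kernel_operator.

(** * Orthonormal families *)

Section orthonormal.
Context {R : realType} (mu : {measure set (measurableTypeR R) -> \bar R}).
Local Notation L2 := (memL2 mu).
Local Notation "<| f , g |>" := (innerH mu f g).

Definition orthonormalH (K : nat) (h : 'I_K -> R -> R) : Prop :=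
  (forall k, L2 (h k)) /\ (forall k l, <|h k, h l|> = (k == l)%:R).

Definition projH (K : nat) (h : 'I_K -> R -> R) (f : R -> R) : R -> R :=
  fun x => \sum_(k < K) <|f, h k|> * h k x.

Section finite_family.
Variables (K : nat) (h : 'I_K -> R -> R).
Hypothesis oh : orthonormalH h.

Lemma memL2_projH f : L2 (projH h f).
Proof. by apply: memL2_sum => k; apply: memL2Z; case: oh. Qed.

Lemma innerH_projH f g : L2 g ->
  <|projH h f, g|> = \sum_(k < K) <|f, h k|> * <|g, h k|>.
Proof.
move=> Lg; have [Lh _] := oh.
rewrite innerH_suml//; last by move=> k; exact: memL2Z.
by apply: eq_bigr => k _; rewrite innerHZl// (innerHC _ (h k)).
Qed.

Lemma normH_projH f : L2 f ->
  normH mu (projH h f) ^+ 2 = \sum_(k < K) <|f, h k|> ^+ 2.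
Proof.
move=> Lf; have [Lh hh] := oh; rewrite normH_sq innerH_projH; last exact: memL2_projH.
apply: eq_bigr => k _; rewrite innerH_projH// expr2; congr (_ * _).
rewrite (bigD1 k)//= hh eqxx mulr1 big1 ?addr0// => l lk.
by rewrite hh eq_sym (negbTE lk) mulr0.
Qed.

(** The inner product of [projH h f] with [f] is the squared norm of the projection; Cauchy-Schwarz
    and division by that norm conclude. *)
Lemma bessel f : L2 f -> \sum_(k < K) <|f, h k|> ^+ 2 <= normH mu f ^+ 2.
Proof.
move=> Lf; have LP := memL2_projH f; rewrite -normH_projH//.
have : normH mu (projH h f) ^+ 2 <= normH mu (projH h f) * normH mu f.
  rewrite (le_trans _ (innerH_cauchy_schwarz LP Lf))// (le_trans _ (ler_norm _))//.
  by rewrite innerH_projH// normH_projH//.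
have := normH_ge0 mu (projH h f); have := normH_ge0 mu f.
move: (normH mu f) (normH mu (projH h f)) => a b a0 b0.
rewrite expr2; have [->|bn0] := eqVneq b 0; first by rewrite !mul0r sqr_ge0.
rewrite ler_pM2l; last by rewrite lt0r bn0.
by move=> ba; rewrite -expr2 lerXn2r.
Qed.

End finite_family.

(** By contraposition: if every tail has a term at most [r], all tail infima, and so their limit,
    are at most [r]. *)
Lemma limn_einf_gt_near (u : nat -> R) (r : R) : (r%:E < limn_einf (EFin \o u))%E ->
  exists n, forall m, (n <= m)%N -> r < u m.
Proof.
move=> ru; apply: contrapT => /forallNP H; move: ru; apply/negP; rewrite -leNgt.
rewrite limn_einf_lim; apply: lime_le.
  exact: is_cvg_einfs.
apply: nearW => n; have /existsNP[m /not_implyP[nm /negP]] := H n.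
rewrite -leNgt => um; apply: ge_ereal_inf; exists (u m)%:E => //.
by exists m.
Qed.

(* Almost everywhere convergence of the projections and Fatou's lemma give
   [liminf ||P_m f|| >= ||f||], with no appeal to density of the family. *)
Lemma orthonormal_lower_bound (K : nat -> nat) (h : forall m, 'I_(K m) -> R -> R) f :
  (forall m, orthonormalH (h m)) -> L2 f ->
  {ae mu, forall x, projH (h m) f x @[m --> \oo] --> f x} ->
  forall r, r < normH mu f ^+ 2 ->
  exists n, forall m, (n <= m)%N -> r < \sum_(k < K m) <|f, h m k|> ^+ 2.
Proof.
move=> oh Lf [N [mN muN cN]] r rf; apply: limn_einf_gt_near.
apply: (@lt_le_trans _ _ (normH mu f ^+ 2)%:E); first by rewrite lte_fin.
have int_sq g : L2 g -> (\int[mu]_x (g x ^+ 2)%:E)%E = (normH mu g ^+ 2)%:E.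
  move=> Lg; rewrite normH_sq /innerH fineK.
    by apply: eq_integral => x _; rewrite expr2.
  by apply: integrable_fin_num => //; exact: memL2_integrable.
have mCN : measurable (~` N) by exact: measurableC.
pose G (m : nat) (x : measurableTypeR R) : \bar R := (projH (h m) f x ^+ 2)%:E.
have mG D m : measurable_fun D (G m).
  apply/measurable_EFinP; apply: measurable_funX; apply: measurable_funTS.
  by have [] := memL2_projH (oh m) f.
have G0 m x : (0 <= G m x)%E by rewrite lee_fin sqr_ge0.
have fat := @fatou _ _ _ mu (~` N) mCN G (mG _) (fun n x _ => G0 n x).
(* Off the null set [N] the projections converge, so the lower limit of [G] there is the square of
   [f]. *)
apply: (@le_trans _ _ (\int[mu]_(x in ~` N) limn_einf (G ^~ x))%E).
  rewrite -int_sq// (ge0_negligible_integral _ _ _ _ muN)//; last 2 first.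
  - by apply/measurable_EFinP; apply: measurable_funX; case: Lf.
  - by move=> x _; rewrite lee_fin sqr_ge0.
  rewrite setTD le_eqVlt; apply/orP; left; apply/eqP.
  apply: eq_integral => x; rewrite inE => Nx; apply/esym.
  have : projH (h m) f x @[m --> \oo] --> f x by apply: contrapT => /cN.
  move=> cx; apply: (cvg_limn_einf_sup _).1.
  by apply: cvg_EFin; [exact: nearW|apply: cvgM].
apply: (le_trans fat).
rewrite limn_einf_lim [leRHS]limn_einf_lim; apply: lee_lim.
- exact: is_cvg_einfs.
- exact: is_cvg_einfs.
apply: nearW => n; apply: le_ereal_inf_tmp => _ [m /= nm <-].
apply: ge_ereal_inf; exists (\int[mu]_(x in ~` N) G m x)%E; first by exists m.
rewrite /= -(normH_projH (oh m) Lf).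
rewrite -int_sq; last exact: memL2_projH (oh m) f.
exact: ge0_subset_integral.
Qed.

End orthonormal.

(** * Normalised indicators of disjoint sets *)

Section normalized_indicators.
Context {R : realType} (mu : {measure set (measurableTypeR R) -> \bar R}).

Lemma memL2_indic (A : set R) : measurable A -> (mu A < +oo)%E -> memL2 mu \1_A.
Proof.
move=> mA Afin; split; first exact: measurable_indic.
rewrite (_ : integral _ _ _ = \int[mu]_x (\1_A x)%:E)%E.
  by rewrite integral_indic ?setIT.
by apply: eq_integral => x _; rewrite indicE; case: (x \in A); rewrite ?expr1n ?expr0n.
Qed.

Lemma innerH_indic (f : R -> R) (A : set R) :
  innerH mu f \1_A = \int[mu]_(x in A) f x.
Proof.
rewrite Rintegral_mkcond; apply: eq_Rintegral => x _.
by rewrite patchE indicE; case: (x \in A); rewrite ?mulr1 ?mulr0.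
Qed.

Variables (K : nat) (I : 'I_K -> set R) (s : 'I_K -> R).
Hypothesis mI : forall k, measurable (I k).
Hypothesis disjI : forall k l x, I k x -> I l x -> k = l.
Hypothesis muI : forall k, mu (I k) = (s k)%:E.
Hypothesis s_gt0 : forall k, 0 < s k.

Definition nindic (k : 'I_K) : R -> R := fun x => (Num.sqrt (s k))^-1 * \1_(I k) x.

Let L2I k : memL2 mu \1_(I k).
Proof. by apply: memL2_indic => //; rewrite muI ltry. Qed.

Let sqrt_sq k : (Num.sqrt (s k))^-1 * (Num.sqrt (s k))^-1 = (s k)^-1.
Proof. by rewrite -invfM -expr2 sqr_sqrtr// ltW. Qed.

Lemma orthonormal_nindic : orthonormalH mu nindic.
Proof.
split=> [k|k l]; first exact: memL2Z.
rewrite /nindic innerHZl//; last exact: memL2Z.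
rewrite innerHC innerHZl// innerHC innerH_indic.
rewrite /Rintegral (_ : integral _ _ _ = mu (I k `&` I l)); last first.
  by apply: integral_indic; exact: mI.
have [<-|kl] := eqVneq k l.
  by rewrite setIid muI/= mulrA sqrt_sq mulVf// gt_eqF.
rewrite (_ : _ `&` _ = set0) ?measure0/= ?mulr0//.
by apply/seteqP; split=> // x [Ik Il]; move: kl; rewrite (disjI Ik Il) eqxx.
Qed.

(** Only the set containing [x] contributes, and its two normalising factors combine: the projection
    averages [f] over that set. *)
Lemma projH_nindic (f : R -> R) k x : memL2 mu f -> I k x ->
  projH mu nindic f x = (s k)^-1 * \int[mu]_(x in I k) f x.
Proof.
move=> Lf Ikx; rewrite /projH (bigD1 k)//= [X in _ + X]big1 ?addr0.
  rewrite /nindic innerHC innerHZl// innerHC innerH_indic indicE mem_set// mulr1.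
  by rewrite mulrAC sqrt_sq.
move=> l lk; rewrite /nindic indicE memNset ?mulr0// => Il.
by move: lk; rewrite (disjI Ikx Il) eqxx.
Qed.

End normalized_indicators.

(** * Almost everywhere approximation by local averages *)

Section approximation.
Context {R : realType} (mu : {measure set (measurableTypeR R) -> \bar R}).

(** A substitute for an orthonormal basis: the families may change entirely with [m], and
    convergence is pointwise almost everywhere. *)
Definition complete_approx : Prop :=
  exists (K : nat -> nat) (h : forall m, 'I_(K m) -> R -> R),
    (forall m, orthonormalH mu (h m)) /\
    (forall f, memL2 mu f -> {ae mu, forall x, projH mu (h m) f x @[m --> \oo] --> f x}).

(** Averaging over a single atom returns the value of [f] there, so the projection is exact on the
    atoms for every [m]; their complement is null. *)
Lemma complete_approx_counting (d : nat) : (forall A, measurable A ->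
    mu A = counting (A `&` [set (k.+1)%:R | k in [set k : nat | (k < d)%N]])) ->
  complete_approx.
Proof.
move=> muE.
pose p (k : 'I_d) : R := k.+1%:R.
have mI k : measurable [set p k] by [].
have muI k : mu [set p k] = 1%:E.
  rewrite muE// (_ : _ `&` _ = [set p k]).
    rewrite /counting asboolT; last exact: finite_set1.
    by rewrite fset_set1 finmap.cardfs1.
  by apply: setIidl => _ ->; exists (k : nat) => //=.
have dI (k l : 'I_d) x : [set p k] x -> [set p l] x -> k = l.
  move=> -> /eqP; rewrite /p eqr_nat eqSS => /eqP kl; exact: val_inj.
pose h := nindic (fun k => [set p k]) (fun=> 1).
have oh : orthonormalH mu h by exact: orthonormal_nindic.
exists (fun=> d), (fun=> h); split=> // f Lf.
have mS : measurable ([set (k.+1)%:R | k in [set k : nat | (k < d)%N]] : set R).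
  rewrite (_ : image _ _ = \bigcup_(k in [set k : nat | (k < d)%N]) [set k.+1%:R]).
    exact: bigcup_measurable.
  by apply/seteqP; split=> [_ [k kd <-]|_ [k kd ->]]; exists k.
exists (~` [set (k.+1)%:R | k in [set k : nat | (k < d)%N]]); split.
- exact: measurableC.
- rewrite muE; last exact: measurableC.
  by rewrite setICl /counting asboolT// fset_set0.
move=> x /= nx kx; apply: nx; case: kx => k kd <-.
rewrite (_ : (fun=> _) = (fun=> f k.+1%:R)); first exact: cvg_cst.
apply/funext => m; rewrite (@projH_nindic R mu d (fun k => [set p k]) (fun=> 1) mI dI muI
  (fun=> ltr01) f (Ordinal kd))//.
rewrite invr1 mul1r (@eq_Rintegral _ _ _ mu _ (cst (f k.+1%:R))); last first.
  by move=> y; rewrite inE => ->.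
by rewrite Rintegral_cst// muI mulr1.
Qed.

Variables (a b : R).
Hypothesis ab : a < b.
Hypothesis muE : forall A, measurable A -> mu A = lebesgue_measure (A `&` `[a, b]).

Let w (m : nat) : R := (b - a) / m.+1%:R.

Let w_gt0 m : 0 < w m.
Proof. by rewrite divr_gt0// subr_gt0. Qed.

(** Indexing by all integers tiles the line, so that the floor function picks a cell for any real
    [x]; the indices from 0 to [m] tile [[a, b[]. *)
Let cell m (z : int) : set R := `[a + z%:~R * w m, a + (z + 1)%:~R * w m[%classic.

Let cellP m z x : cell m z x <-> Num.floor ((x - a) / w m) = z.
Proof.
rewrite /cell /= in_itv/= -lerBrDl -ltrBlDl -ler_pdivlMr// -ltr_pdivrMr//.
split=> [H|<-]; first exact: floor_def.
exact: floor_itv.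
Qed.

Let measurable_cell m z : measurable (cell m z).
Proof. exact: measurable_itv. Qed.

Let leb_cell m z : lebesgue_measure (cell m z) = (w m)%:E.
Proof.
rewrite lebesgue_measure_itv/= lte_fin ltrD2l ltr_pM2r// ltr_int ltrDl ltr01.
by rewrite -EFinB; congr EFin; rewrite intrD; ring.
Qed.

Let cell_sub m (k : 'I_m.+1) : cell m k `<=` `[a, b].
Proof.
move=> x; rewrite /cell /= !in_itv/= => /andP[ax xb]; apply/andP; split.
  by rewrite (le_trans _ ax)// lerDl mulr_ge0// ltW.
rewrite (le_trans (ltW xb))// -lerBrDl /w mulrCA; apply: ler_piMr.
  by rewrite subr_ge0 ltW.
rewrite ler_pdivrMr ?ltr0n// mul1r (_ : (_ + 1)%:~R = k.+1%:R :> R).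
  by rewrite ler_nat ltn_ord.
by rewrite intrD -natr1.
Qed.

Let mu_cell m (k : 'I_m.+1) : mu (cell m k) = (w m)%:E.
Proof. by rewrite (muE (measurable_cell m k)) (setIidl (@cell_sub m k)) leb_cell. Qed.

Let h (m : nat) : 'I_m.+1 -> R -> R := nindic (fun k : 'I_m.+1 => cell m k) (fun=> w m).

Let cell_disj m (k l : 'I_m.+1) x : cell m k x -> cell m l x -> k = l.
Proof. by move=> /cellP fk /cellP; rewrite fk => -[] /val_inj. Qed.

Let orthonormal_h m : orthonormalH mu (@h m).
Proof.
by apply: orthonormal_nindic => //; exact: cell_disj.
Qed.

Let E x m := cell m (Num.floor ((x - a) / w m)).

Let nicely_E x : nicely_shrinking x (E x).
Proof.
split=> [m|]; first exact: measurable_cell.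
(* A cell of width [w m] lies in the ball of that radius about any of its points, and this ball has
   twice its measure. *)
exists (2, fun m => PosNum (w_gt0 m)); split => //=.
- rewrite -(mulr0 (b - a)); apply: cvgMl_tmp; exact: cvg_harmonic.
- move=> m y; have : E x m x by apply/cellP.
  rewrite /E /cell/= !in_itv/= => /andP[x1 x2] /andP[y1 y2].
  rewrite /ball/= ltr_norml; move: x1 x2 y1 y2; rewrite !intrD !mulrDl mul1r.
  by move: (_ * w m) => u *; apply/andP; split; lra.
- by move=> m; rewrite lebesgue_measure_ball ?(ltW (w_gt0 m))// leb_cell -EFinM mulr_natl.
Qed.

Lemma complete_approx_lebesgue : complete_approx.
Proof.
exists succn, @h; split=> [m|f Lf]; first exact: orthonormal_h.
have mab : @measurable _ (measurableTypeR R) `[a, b]%classic by exact: measurable_itv.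
have mu_leb (D : set R) (g : R -> \bar R) : D `<=` `[a, b] ->
    (\int[mu]_(x in D) g x = \int[lebesgue_measure]_(x in D) g x)%E.
  move=> Dab; apply: eq_measure_integral => A mA AD; rewrite muE// setIidl//.
  exact: subset_trans Dab.
have mu_fin : (mu setT < +oo)%E.
  by rewrite muE// setTI lebesgue_measure_itv/=; case: ifP => // _; rewrite -EFinB ltry.
have fint : lebesgue_measure.-integrable `[a, b]%classic (EFin \o f).
  (* Since [mu] is finite the constant 1 is square integrable, and multiplying by it turns square
     integrability of [f] into integrability. *)
  have : mu.-integrable setT (EFin \o (fun x => f x * \1_[set: R] x)).
    apply: memL2_integrable => //; exact: memL2_indic.
  move=> fi0; have := integrableS measurableT mab (@subsetT _ _) fi0.
  case/integrableP => _ fi.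
  apply/integrableP; split.
    by apply/measurable_EFinP; apply: measurable_funTS; case: Lf.
  rewrite -mu_leb//; move: fi; under eq_integral do rewrite /= indicT mulr1.
  by [].
have lF := integrable_locally_restrict mab fint.
have ae1 : {ae mu, forall x, lebesgue_pt (f \_ `[a, b]) x}.
  have [N [mN N0 NP]] := lebesgue_differentiation lF; exists N; split=> //.
  rewrite muE//; apply/eqP; rewrite eq_le measure_ge0 andbT -N0.
  apply: le_measure; rewrite ?inE//; exact: measurableI.
(* The cells are half-open, so the endpoint [b] lies in none of the first [m.+1]; it is a null
   set. *)
have ae2 : {ae mu, forall x, x \in `[a, b[}.
  exists (~` `[a, b[%classic); split.
  - by apply: measurableC; exact: measurable_itv.
  - rewrite muE; last by apply: measurableC; exact: measurable_itv.
    rewrite (_ : _ `&` _ = [set b]) ?lebesgue_measure_set1//.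
    apply/seteqP; split=> x /=; rewrite !in_itv/=.
      move=> [/negP + /andP[ax xb]]; rewrite ax/= -leNgt => bx.
      by apply/eqP; rewrite eq_le xb.
    by move=> ->; rewrite ltxx andbF lexx (ltW ab).
  - by move=> x.
move: ae1 ae2; apply: (@filterS2 _ _ (ae_filter_ringOfSetsType mu)) => x lx xab.
have := nice_lebesgue_differentiation nicely_E lF lx => /fine_cvg.
have -> : (f \_ `[a, b]) x = f x.
  rewrite patchE mem_set//=; move: xab; rewrite !in_itv/= => /andP[-> /ltW ->].
  by [].
rewrite (_ : (fine \o _) = (fun m => projH mu (@h m) f x))//; apply/funext => m /=.
have [k kE] : exists k : 'I_m.+1, Num.floor ((x - a) / w m) = k.
  move: xab; rewrite in_itv/= => /andP[ax xb].
  have fl0 : 0 <= Num.floor ((x - a) / w m).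
    by rewrite floor_ge0 divr_ge0 ?subr_ge0// ltW.
  have fl1 : Num.floor ((x - a) / w m) < m.+1%:Z.
    rewrite floor_lt_int ltr_pdivrMr// -pmulrn /w mulrC divfK ?pnatr_eq0//.
    by rewrite ltrD2r.
  case: (Num.floor _) fl0 fl1 => // n _ nm.
  by exists (Ordinal (nm : (n < m.+1)%N)).
have kx : cell m k x by apply/cellP.
rewrite (@projH_nindic R mu _ (fun k : 'I_m.+1 => cell m k) (fun=> w m)
  (fun k => measurable_cell m k) (@cell_disj m) (@mu_cell m) (fun=> w_gt0 m) f k)//.
rewrite /E kE leb_cell inver gt_eqF//.
rewrite (_ : integral _ _ _ = \int[lebesgue_measure]_(y in cell m k) (f y)%:E)%E.
  rewrite fineM//; first by rewrite /Rintegral mu_leb//; exact: cell_sub.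
  apply: integrable_fin_num; first exact: measurable_cell.
  by apply: integrableS fint => //; exact: measurable_cell.
apply: eq_integral => y; rewrite inE => /(@cell_sub m k) yab.
by rewrite patchE mem_set.
Qed.

End approximation.

Lemma std_space_fin (R : realType) (mu : {measure set (measurableTypeR R) -> \bar R}) :
  std_space mu -> (mu setT < +oo)%E.
Proof.
case=> [[a [b [ab muE]]]|[d [d0 muE]]]; rewrite muE// setTI.
  by rewrite lebesgue_measure_itv/=; case: ifP => // _; rewrite -EFinB ltry.
rewrite /counting asboolT ?ltry//; apply: finite_image; exact: finite_II.
Qed.

Lemma std_space_approx (R : realType) (mu : {measure set (measurableTypeR R) -> \bar R}) :
  std_space mu -> complete_approx mu.
Proof.
case=> [[a [b [ab muE]]]|[d [d0 muE]]]; first exact: (complete_approx_lebesgue ab muE).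
exact: (complete_approx_counting muE).
Qed.

(** * Concentration in L2 *)

Section H_concentration.
Context {R : realType} (mu : {measure set (measurableTypeR R) -> \bar R}).
Context {dO : measure_display} {Omega : measurableType dO} (P : probability Omega R).
Variables (n : nat) (X : 'I_n -> Omega -> R -> R) (c : 'I_n -> R) (sigma : R).
Hypothesis std_mu : std_space mu.
Hypothesis randX : forall i, H_random_element mu (X i).
Hypothesis indepX : H_independent mu P X.
Hypothesis meanX : forall i, H_mean_zero mu P (X i).
Hypothesis sigma_ge0 : 0 <= sigma.
Hypothesis boundX : forall i, {ae P, forall w, normH mu (X i w) <= sigma}.

Let HG : set (set (R -> R)) :=
  [set A | exists h B, memL2 mu h /\ measurable (B : set R) /\
             A = [set f | B (innerH mu f h)]].
Let HT := g_sigma_algebraType HG.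

Let F (i : 'I_n) : set (set Omega) := [set X i @^-1` A | A in Hmeasurable mu].

Let indepF : indep_systems P F.
Proof.
split.
- by move=> i _ [A HA <-]; have [_] := randX i; exact.
- move=> i _ _ [A HA <-] [B HB <-]; exists (A `&` B) => //.
  exact: (@measurableI _ HT).
- by move=> i; exists setT => //; exact: (@measurableT _ HT).
- move=> E FE; pose A i := sval (cid2 (FE i)).
  have HA i : Hmeasurable mu (A i) by rewrite /A; case: cid2.
  have XA i : X i @^-1` (A i) = E i by rewrite /A; case: cid2.
  have := indepX HA; under [in X in _ = X -> _]eq_bigr do rewrite XA.
  move=> <-; congr (P _); apply/seteqP; split=> w /= Ew i.
    by have := Ew i I; rewrite -XA.
  by move=> _; rewrite -XA; exact: Ew.
Qed.

Let S (w : Omega) : R -> R := fun x => \sum_(i < n) c i * X i w x.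

Let L2X i w : memL2 mu (X i w). Proof. by case: (randX i). Qed.

Let L2S w : memL2 mu (S w).
Proof. by apply: memL2_sum => i; exact: memL2Z. Qed.

Let measurable_innerH h : memL2 mu h ->
  measurable_fun [set: HT] ((innerH mu ^~ h) : HT -> R).
Proof.
move=> Lh _ B mB; rewrite setTI; apply: sub_sigma_algebra.
by exists h, B.
Qed.

Section one_family.
Variables (K : nat) (h : 'I_K -> R -> R) (delta b : R).
Hypothesis oh : orthonormalH mu h.
Hypothesis delta_gt0 : 0 < delta.
Hypothesis b_ge0 : 0 <= b.
Hypothesis cb : \sum_(i < n) (c i * sigma) ^+ 2 <= b ^+ 2.

(* The noise is bounded only almost surely; truncating its coordinates makes the
   bound hold everywhere and keeps them functions of the same random element. *)
Let trunc (k : 'I_K) (f : HT) : R :=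
  if \sum_(l < K) innerH mu f (h l) ^+ 2 <= sigma ^+ 2 then innerH mu f (h k) else 0.

Let Lh k : memL2 mu (h k). Proof. by case: oh. Qed.

Let measurable_trunc k : measurable_fun [set: HT] (trunc k).
Proof.
apply: measurable_fun_ifT => //; last exact: measurable_innerH.
apply: measurable_fun_ler => //; apply: measurable_sum => l.
by apply: measurable_funX; exact: measurable_innerH.
Qed.

Let sum_trunc f : \sum_(k < K) trunc k f ^+ 2 <= sigma ^+ 2.
Proof.
case: (lerP (\sum_(l < K) innerH mu f (h l) ^+ 2) (sigma ^+ 2)) => H.
  by rewrite (eq_bigr (fun k => innerH mu f (h k) ^+ 2))// => k _; rewrite /trunc H.
by rewrite big1 ?sqr_ge0// => k _; rewrite /trunc leNgt H expr0n.
Qed.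

Let trunc_bound k f : `|trunc k f| <= sigma.
Proof.
rewrite -(@ler_pXn2r _ 2) ?nnegrE// real_normK ?num_real//.
rewrite (le_trans _ (sum_trunc f))// (bigD1 k)//= lerDl sumr_ge0// => l _.
exact: sqr_ge0.
Qed.

(** Bessel's inequality keeps the coordinates within the threshold whenever the noise obeys its
    bound. *)
Let trunc_id k i w : normH mu (X i w) <= sigma -> trunc k (X i w) = innerH mu (X i w) (h k).
Proof.
move=> Xs; rewrite /trunc ifT// (le_trans (bessel oh (L2X i w)))// lerXn2r ?nnegrE//.
exact: normH_ge0.
Qed.

Let F_trunc k i (B : set R) : measurable B -> F i ((fun w => trunc k (X i w)) @^-1` B).
Proof.
move=> mB; exists (trunc k @^-1` B) => //.
by have := measurable_trunc k measurableT mB; rewrite setTI.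
Qed.

Let measurable_truncX k i : measurable_fun setT (fun w => trunc k (X i w)).
Proof.
by move=> _ B mB; rewrite setTI; have [Fm _ _ _] := indepF; apply: (Fm i); exact: F_trunc.
Qed.

Let measurable_innerX k i : measurable_fun setT (fun w => innerH mu (X i w) (h k)).
Proof.
move=> _ B mB; rewrite setTI; have [Fm _ _ _] := indepF; apply: (Fm i).
exists [set f | B (innerH mu f (h k))] => //.
by have := measurable_innerH (Lh k) measurableT mB; rewrite setTI.
Qed.

Let xi i k w := c i * trunc k (X i w).

Let mean_xi i k : (\int[P]_w (xi i k w)%:E = 0)%E.
Proof.
have it : P.-integrable setT (EFin \o (fun w => trunc k (X i w))).
  exact: (@bounded_integrable _ _ _ P _ sigma).
rewrite /xi; under eq_integral do rewrite EFinM.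
rewrite (integralZl measurableT it) (_ : integral _ _ _ = 0%E) ?mule0//.
rewrite -[RHS](meanX i (Lh k)); apply: ae_eq_integral => //.
- exact/measurable_EFinP.
- exact/measurable_EFinP.
- move: (boundX i); apply: (@filterS _ _ (ae_filter_ringOfSetsType P)) => w Xs _ /=.
  by rewrite trunc_id.
Qed.

Let measurable_normS : measurable_fun setT
  (fun w => Num.sqrt (\sum_(k < K) innerH mu (S w) (h k) ^+ 2)).
Proof.
apply: (measurableT_comp measurable_sqrt); apply: measurable_sum => k.
apply: measurable_funX.
rewrite (_ : (fun w => _) = (fun w => \sum_(i < n) c i * innerH mu (X i w) (h k))).
  by apply: measurable_sum => i; apply: measurable_funM.
apply/funext => w; rewrite innerH_suml//; last by move=> i; exact: memL2Z.
by apply: eq_bigr => i _; rewrite innerHZl.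
Qed.

Lemma coordinate_tail :
  let A := [set w | delta * b < Num.sqrt (\sum_(k < K) innerH mu (S w) (h k) ^+ 2)] in
  measurable A /\ (P A <= (2 * expR (- (delta ^+ 2) / 2))%:E)%E.
Proof.
move=> A.
have tailP B (f : Omega -> R) : measurable_fun setT f -> measurable [set w | B < f w].
  move=> mf; rewrite (_ : [set w | _] = f @^-1` `]B, +oo[%classic).
    by rewrite -[X in measurable X]setTI; apply: mf.
  by apply/seteqP; split=> w /=; rewrite in_itv/= andbT.
have mA : measurable A by exact: tailP.
split=> //.
pose A' := [set w | delta * b < Num.sqrt (\sum_(k < K) (\sum_(i < n) xi i k w) ^+ 2)].
have mA' : measurable A'.
  apply: tailP; apply: (measurableT_comp measurable_sqrt); apply: measurable_sum => k.
  apply: measurable_funX; apply: measurable_sum => i; exact: measurable_funM.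
have PA' : (P A' <= (2 * expR (- (delta ^+ 2) / 2))%:E)%E.
  apply: (@pinelis_tail _ _ _ P n K F _ (fun i => `|c i| * sigma)) => //.
  - move=> i k B mB; apply: (@F_trunc k i (( *%R (c i)) @^-1` B)).
    by rewrite -[X in measurable X]setTI; exact: mulrl_measurable.
  - by move=> i; rewrite mulr_ge0.
  - move=> i w; rewrite /xi exprMn real_normK ?num_real//.
    under eq_bigr do rewrite exprMn.
    by rewrite -mulr_sumr ler_wpM2l ?sqr_ge0// sum_trunc.
  - by under eq_bigr do rewrite exprMn real_normK ?num_real// -exprMn.
(* One null set for all the units: outside it no truncation is active, so [A] is contained in the
   union of [A'] and [N]. *)
have [N [mN N0 NP]] := filter_forall (ae_filter_ringOfSetsType P) boundX.
apply: (le_trans _ PA'); rewrite -[leRHS]adde0 -N0.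
apply: (@le_trans _ _ (P (A' `|` N))); last exact: measureU2.
apply: le_measure; rewrite ?inE//; first exact: measurableU.
move=> w Aw; have [Nw|Nw] := pselect (N w); [by right|left].
have Xs i : normH mu (X i w) <= sigma.
  by have : forall i, normH mu (X i w) <= sigma by apply: contrapT => /NP.
rewrite /A' /=; move: Aw; rewrite /A/=; congr (_ < Num.sqrt _).
apply: eq_bigr => k _; congr (_ ^+ 2).
rewrite innerH_suml//; last by move=> i; exact: memL2Z.
by apply: eq_bigr => i _; rewrite innerHZl// /xi trunc_id.
Qed.

End one_family.

(** The bound of [coordinate_tail] is the same for every family. The norm event is an increasing
    union of intersections of coordinate events, so it is measurable and inherits the bound by
    continuity from below. *)
Lemma H_concentration (delta b : R) : 0 < delta -> 0 <= b ->
  \sum_(i < n) (c i * sigma) ^+ 2 <= b ^+ 2 ->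
  let B := [set w | delta * b < normH mu (fun x => \sum_(i < n) c i * X i w x)] in
  measurable B /\ (P B <= (2 * expR (- (delta ^+ 2) / 2))%:E)%E.
Proof.
move=> d0 b0 cb B; have [K [h [oh hcvg]]] := std_space_approx std_mu.
pose A m := [set w | delta * b < Num.sqrt (\sum_(k < K m) innerH mu (S w) (h m k) ^+ 2)].
have mA m : measurable (A m) by have [] := coordinate_tail (oh m) d0 b0 cb.
have PA m : (P (A m) <= (2 * expR (- (delta ^+ 2) / 2))%:E)%E.
  by have [] := coordinate_tail (oh m) d0 b0 cb.
pose D m := \bigcap_(l in [set l | (m <= l)%N]) A l.
have mD m : measurable (D m) by apply: bigcap_measurable => //; exists m => /=.
have BE : B = \bigcup_m D m.
  apply/seteqP; split=> [w|w [m _ /(_ m (leqnn m))]]; last first.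
    rewrite /A /B/= => /lt_le_trans; apply.
    by rewrite -[leRHS]ger0_norm ?normH_ge0// -sqrtr_sqr ler_wsqrtr// bessel.
  rewrite /B/= => Bw.
  (* The strict inequality leaves room for [orthonormal_lower_bound], which puts [w] in all [A l]
     with [l] large. *)
  have : (delta * b) ^+ 2 < normH mu (S w) ^+ 2.
    by rewrite ltrXn2r// ?nnegrE ?normH_ge0// mulr_ge0// ltW.
  move=> /(orthonormal_lower_bound oh (L2S w) (hcvg _ (L2S w))) [m mP].
  exists m => // l /= ml; rewrite /A/=.
  rewrite -[ltLHS]ger0_norm ?mulr_ge0// ?(ltW d0)// -sqrtr_sqr ltr_sqrt ?mP//.
  by rewrite (le_lt_trans _ (mP _ ml))// sqr_ge0.
have mB : measurable B by rewrite BE; exact: bigcupT_measurable.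
split=> //.
have ndD : nondecreasing_seq D.
  move=> m l ml; apply/subsetPset => w Dw j /= lj; apply: Dw.
  exact: leq_trans lj.
have := @nondecreasing_cvg_mu _ _ _ P D mD _ ndD; rewrite -BE => /(_ mB) cD.
rewrite -(cvg_lim _ cD)//; apply: lime_le; first by apply/cvg_ex; eexists; exact: cD.
apply: nearW => m /=; apply: (le_trans _ (PA m)); apply: le_measure; rewrite ?inE//.
by move=> w /(_ m (leqnn m)).
Qed.

End H_concentration.

(** * The weighting estimator *)

(** The whole space is not negligible, so some point satisfies the bound. This yields the sign of
    [sigma]. *)
Lemma ae_bound_ge0 {d : measure_display} {T : measurableType d} {R : realType}
    (P : probability T R) (f : T -> R) (s : R) :
  (forall w, 0 <= f w) -> {ae P, forall w, f w <= s} -> 0 <= s.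
Proof.
move=> f0 [N [mN N0 NP]]; rewrite leNgt; apply/negP => s0.
have NT : N = setT.
  rewrite -subTset => w _; apply: NP => /= fs.
  by have := le_lt_trans (le_trans (f0 w) fs) s0; rewrite ltxx.
by move: N0; rewrite NT probability_setT => /eqP; rewrite onee_eq0.
Qed.

Section regression.
Context {R : realType} (mu : {sigma_finite_measure set (measurableTypeR R) -> \bar R}).
Variables (T0 p : nat) (beta : 'I_T0 -> R * R -> R) (eta : 'I_p -> R -> R).
Hypothesis L2beta : forall t, memL2ker mu (beta t).
Hypothesis L2eta : forall l, memL2 mu (eta l).

(** The triangle inequality separates the three contributions; Cauchy-Schwarz over periods and over
    covariates then gives the products of square roots. *)
Lemma normH_regression (f : 'I_T0 -> R -> R) (z : 'I_p -> R) (e : R -> R) :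
  (forall t, memL2 mu (f t)) -> memL2 mu e ->
  normH mu (fun x => \sum_(t < T0) kerop mu (beta t) (f t) x +
    \sum_(l < p) z l * eta l x + e x) <=
  Num.sqrt (\sum_(t < T0) normker2 mu (beta t)) *
    Num.sqrt (\sum_(t < T0) normH mu (f t) ^+ 2) +
  Num.sqrt (\sum_(l < p) normH mu (eta l) ^+ 2) * euclid_norm z + normH mu e.
Proof.
move=> Lf Le.
have Lk t : memL2 mu (kerop mu (beta t) (f t)) by exact: memL2_kerop.
have Lz l : memL2 mu (fun x => z l * eta l x) by exact: memL2Z.
have LK := memL2_sum (index_enum 'I_T0) Lk.
have LZ := memL2_sum (index_enum 'I_p) Lz.
rewrite (le_trans (normHD (memL2D LK LZ) Le))// lerD2r.
rewrite (le_trans (normHD LK LZ))// lerD//.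
- rewrite (le_trans (normH_sum _ Lk))//.
  rewrite (le_trans (ler_sum _ (fun t _ => normH_kerop (L2beta t) (Lf t))))//.
  rewrite (le_trans (ler_norm _))// (le_trans (cauchy_schwarz_sum _ _ _))//.
  rewrite ler_wpM2r ?sqrtr_ge0// ler_wsqrtr// ler_sum// => t _.
  by rewrite sqr_sqrtr// normker2_ge0.
- rewrite (le_trans (normH_sum _ Lz))//.
  under eq_bigr do rewrite normHZ// mulrC.
  rewrite (le_trans (ler_norm _))// (le_trans (cauchy_schwarz_sum _ _ _))//.
  rewrite ler_wpM2l ?sqrtr_ge0// ler_wsqrtr// ler_sum// => l _.
  by rewrite real_normK ?num_real.
Qed.

End regression.

(** Treated minus weighted controls becomes one weighted sum over all units, the form in which the
    noise concentration applies. *)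
Lemma sum_contrast {R : realType} (n : nat) (gamma : 'I_n -> R) (F : 'I_n.+1 -> R) :
  \sum_(i < n.+1) oapp (fun j => - gamma j) 1 (unlift ord0 i) * F i =
  F ord0 - \sum_(j < n) gamma j * F (lift ord0 j).
Proof.
rewrite big_ord_recl unlift_none/= mul1r -sumrN; congr (_ + _).
by apply: eq_bigr => j _; rewrite liftK/= mulNr.
Qed.
(* Units: 'I_Nc.+1, unit ord0 is the treated unit (unit 1 of the paper),
   controls are lift ord0 j, j : 'I_Nc (units 2..N of the paper; N = Nc+1).
   Pre-treatment periods: 'I_T0 (t = 1..T0); post period T = T0+1. *)
Theorem theoremB1 (R : realType)
  (mu : {measure set (measurableTypeR R) -> \bar R})
  (M : Type) (d : M -> M -> R) (Psi : M -> R -> R)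
  (dO : measure_display) (Omega : measurableType dO) (P : probability Omega R)
  (Nc T0 p : nat)
  (Ypre : 'I_Nc.+1 -> 'I_T0 -> R -> R)          (* Y_{it} = Y^N_{it}, t <= T0 *)
  (nuN : 'I_Nc.+1 -> Omega -> M)                 (* Psi^{-1}(Y^N_{iT}) *)
  (Z : 'I_Nc.+1 -> 'I_p -> R)
  (beta : 'I_T0 -> R * R -> R) (eta : 'I_p -> R -> R)
  (eps : 'I_Nc.+1 -> Omega -> R -> R) (sigma : R)
  (gamma : 'I_Nc -> R)
  (nuhat : Omega -> M) (delta : R) :
  std_space mu ->
  is_metric d ->
  (forall a, memL2 mu (Psi a)) ->
  (forall a b, d a b = normH mu (Psi a \- Psi b)) ->
  (* Y = Psi(M) is nonempty, convex and closed in H *)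
  (exists a : M, True) ->
  (forall a b (l : R), 0 <= l <= 1 ->
     exists c, {ae mu, forall x, Psi c x = l * Psi a x + (1 - l) * Psi b x}) ->
  (forall (s : nat -> M) (f : R -> R), memL2 mu f ->
     (fun n => normH mu (Psi (s n) \- f)) @ \oo --> 0%R ->
     exists c, {ae mu, forall x, Psi c x = f x}) ->
  (0 < T0)%N ->
  (* pre-treatment outcomes lie in Y *)
  (forall i t, exists a, Ypre i t = Psi a) ->
  (* coefficients *)
  (forall t, memL2ker mu (beta t)) ->
  (forall l, memL2 mu (eta l)) ->
  (* errors: independent, mean-zero, H-valued, a.s. bounded by sigma *)
  (forall i, H_random_element mu (eps i)) ->
  H_independent mu P eps ->
  (forall i, H_mean_zero mu P (eps i)) ->
  (forall i, {ae P, forall w, normH mu (eps i w) <= sigma}) ->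
  (* autoregressive model with covariates, for every unit i *)
  (forall i w, {ae mu, forall x,
     Psi (nuN i w) x =
       \sum_(t < T0) kerop mu (beta t) (Ypre i t) x
       + \sum_(l < p) eta l x * Z i l + eps i w x}) ->
  (* weights *)
  \sum_(j < Nc) gamma j = 1 ->
  (* estimator: Psi (nuhat w) is the projection of
     hatY w = sum_j gamma_j Y_{jT} onto Y, i.e. nuhat = Psi^{-1}(tildeY) *)
  (forall w a,
     normH mu (Psi (nuhat w) \- (fun x => \sum_(j < Nc) gamma j * Psi (nuN (lift ord0 j) w) x))
     <= normH mu (Psi a \- (fun x => \sum_(j < Nc) gamma j * Psi (nuN (lift ord0 j) w) x))) ->
  0 < delta ->
  exists A : set Omega, measurable A /\
    (A `<=` [set w | d (nuN ord0 w) (nuhat w) <=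
        Num.sqrt (\sum_(t < T0) normker2 mu (beta t))
        * Num.sqrt (\sum_(t < T0)
             normH mu (fun x => Ypre ord0 t x
                          - \sum_(j < Nc) gamma j * Ypre (lift ord0 j) t x) ^+ 2)
        + Num.sqrt (\sum_(l < p) normH mu (eta l) ^+ 2)
          * euclid_norm (fun l => Z ord0 l - \sum_(j < Nc) gamma j * Z (lift ord0 j) l)
        + delta * sigma * (1 + euclid_norm gamma)]) /\
    ((1 - 2 * expR (- (delta ^+ 2) / 2))%:E <= P A)%E.
Proof.
move=> std_mu _ L2Psi dE _ convex _ _ Ypsi L2beta L2eta rand indep mean bound model.
move=> _ proj d0.
have [m mE] := finite_sigma_finite (std_space_fin std_mu); subst mu.
pose mu : {measure set (measurableTypeR R) -> \bar R} := m.
have sigma0 : 0 <= sigma by exact: ae_bound_ge0 (fun w => normH_ge0 mu _) (bound ord0).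
pose c (i : 'I_Nc.+1) : R := oapp (fun j => - gamma j) 1 (unlift ord0 i).
pose b := sigma * (1 + euclid_norm gamma).
have g0 : 0 <= euclid_norm gamma by exact: sqrtr_ge0.
have b0 : 0 <= b by rewrite mulr_ge0// addr_ge0.
(* The squared contrast weights sum to [1 + euclid_norm gamma ^+ 2], at most
   [(1 + euclid_norm gamma) ^+ 2]. *)
have cb : \sum_(i < Nc.+1) (c i * sigma) ^+ 2 <= b ^+ 2.
  under eq_bigr do rewrite exprMn.
  rewrite -mulr_suml /b exprMn mulrC ler_wpM2l ?sqr_ge0//.
  rewrite big_ord_recl {1}/c unlift_none/= expr1n.
  rewrite (eq_bigr (fun j => gamma j ^+ 2)); last first.
    by move=> j _; rewrite /c liftK/= sqrrN.
  have -> : \sum_(j < Nc) gamma j ^+ 2 = euclid_norm gamma ^+ 2.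
    by rewrite sqr_sqrtr// sumr_ge0// => j _; exact: sqr_ge0.
  by lra.
have [mB PB] := H_concentration std_mu rand indep mean sigma0 bound d0 b0 cb.
set B := [set w | _] in mB PB.
exists (~` B); split; first exact: measurableC.
split; last first.
  rewrite probability_setC// EFinB leeB//.
move=> w /negP; rewrite -leNgt => Sw /=.
pose e x := \sum_(i < Nc.+1) c i * eps i w x.
have L2eps i : memL2 mu (eps i w) by case: (rand i).
have Le : memL2 mu e by apply: memL2_sum => i; exact: memL2Z.
pose hatY x := \sum_(j < Nc) gamma j * Psi (nuN (lift ord0 j) w) x.
have LhatY : memL2 mu hatY by apply: memL2_sum => j; exact: memL2Z.
have L2Y i t : memL2 mu (Ypre i t) by have [a ->] := Ypsi i t.
pose DY t y := Ypre ord0 t y - \sum_(j < Nc) gamma j * Ypre (lift ord0 j) t y.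
have LDY t : memL2 mu (DY t).
  by apply: memL2B => //; apply: memL2_sum => j; exact: memL2Z.
pose DZ l := Z ord0 l - \sum_(j < Nc) gamma j * Z (lift ord0 j) l.
(* Convexity provides a point of [M] only up to almost everywhere equality, which [normH_ae]
   absorbs. *)
have step1 : d (nuN ord0 w) (nuhat w) <= normH mu (fun x => Psi (nuN ord0 w) x - hatY x).
  rewrite dE; apply: projection_nonexpansive => // l l01.
  have [a aE] := convex (nuN ord0 w) (nuhat w) l l01.
  apply: (le_trans (proj w a)); rewrite le_eqVlt; apply/orP; left; apply/eqP.
  apply: normH_ae; [exact: memL2B|apply: memL2B => //; apply: memL2D; exact: memL2Z|].
  by move: aE; apply: (@filterS _ _ (ae_filter_ringOfSetsType mu)) => x /= ->.
apply: (le_trans step1).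
have -> : normH mu (fun x => Psi (nuN ord0 w) x - hatY x) =
  normH mu (fun x => \sum_(t < T0) kerop mu (beta t) (DY t) x +
    \sum_(l < p) DZ l * eta l x + e x).
  apply: normH_ae; first exact: memL2B.
    apply: memL2D => //; apply: memL2D; apply: memL2_sum => t; last exact: memL2Z.
    exact: memL2_kerop.
  (* The model and the linearity of [kerop] hold almost everywhere; finitely many units and periods
     allow a common null set for each fixed [w]. *)
  have ae1 : {ae mu, forall x, forall t, kerop mu (beta t) (Ypre ord0 t) x -
      \sum_(j < Nc) gamma j * kerop mu (beta t) (Ypre (lift ord0 j) t) x =
      kerop mu (beta t) (DY t) x}.
    apply: (filter_forall (ae_filter_ringOfSetsType mu)) => t.
    exact: keropB_ae.
  have ae2 := filter_forall (ae_filter_ringOfSetsType mu) (model ^~ w).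
  move: ae1 ae2; apply: (@filterS2 _ _ (ae_filter_ringOfSetsType mu)) => x kE mE'.
  have -> : hatY x = \sum_(j < Nc) gamma j *
        \sum_(t < T0) kerop mu (beta t) (Ypre (lift ord0 j) t) x +
      \sum_(j < Nc) gamma j * \sum_(l < p) eta l x * Z (lift ord0 j) l +
      \sum_(j < Nc) gamma j * eps (lift ord0 j) w x.
    by rewrite -!big_split/=; apply: eq_bigr => j _; rewrite mE' !mulrDr.
  rewrite mE' /e sum_contrast.
  have -> : \sum_(t < T0) kerop mu (beta t) (DY t) x =
      \sum_(t < T0) kerop mu (beta t) (Ypre ord0 t) x - \sum_(j < Nc) gamma j *
      \sum_(t < T0) kerop mu (beta t) (Ypre (lift ord0 j) t) x.
    rewrite -(eq_bigr _ (fun t _ => kE t)) sumrB; congr (_ - _).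
    by rewrite exchange_big; apply: eq_bigr => j _; rewrite mulr_sumr.
  have -> : \sum_(l < p) DZ l * eta l x = \sum_(l < p) eta l x * Z ord0 l -
      \sum_(j < Nc) gamma j * \sum_(l < p) eta l x * Z (lift ord0 j) l.
    under [X in _ = _ - X]eq_bigr do rewrite mulr_sumr.
    rewrite exchange_big -sumrB; apply: eq_bigr => l _.
    rewrite /DZ mulrBl mulr_suml [Z ord0 l * _]mulrC; congr (_ - _).
    by apply: eq_bigr => j _; rewrite -mulrA [Z _ _ * _]mulrC.
  ring.
rewrite (le_trans (normH_regression L2beta L2eta DZ LDY Le))// lerD2l.
by rewrite (le_trans Sw)// /b mulrA.
Qed.
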